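(* The map $v\mapsto V^v$, where $V^v[\mu]=\mu\otimes\delta_{v(x)}$, is a monoid isomorphism from $\mathrm{Vec}(\mathbb{R}^n)$ to $\mathrm{PVec}(\mathbb{R}^n)$. Moreover $V^{\lambda v}=\lambda\cdot_f V^v$ (for $\lambda\in\mathbb{R}$ and $v\in\mathrm{Vec}(\mathbb{R}^n)$).
   Context: $T\mathbb{R}^n=\mathbb{R}^n\times\mathbb{R}^n$ with points $(x,v)$, $\pi_1(x,v)=x$, $\pi_{13}(x,v,y,w)=(x,y)$; $\mathcal{P}(X)$ is the set of Borel probability measures on $X$, $\mathcal{P}_c(X)$ those with compact support. A Probability Vector Field (PVF) is a map $V:\mathcal{P}(\mathbb{R}^n)\to\mathcal{P}(T\mathbb{R}^n)$ with $\pi_1\#V[\mu]=\mu$ for every $\mu$. The measure $\mu\otimes\nu_x$ is defined by $\int\phi\,d(\mu\otimes\nu_x)=\int\int\phi(x,v)\,d\nu_x(v)\,d\mu(x)$. For PVFs $V_1,V_2$ with disintegrations $V_i[\mu]=\mu\otimes\nu^i_x[\mu]$, $\lambda\in\mathbb{R}$ and $B\subset T\mathbb{R}^n$ Borel: $$(V_1\oplus_f V_2)[\mu](B)=\int_{\mathbb{R}^n}\int_{(\mathbb{R}^n)^2}\chi_B(x,v+w)\,d\nu^1_x[\mu](v)\,d\nu^2_x[\mu](w)\,d\mu(x),$$ $$(\lambda\cdot_f V_1)[\mu](B)=\int_{\mathbb{R}^n}\int_{\mathbb{R}^n}\chi_B(x,\lambda v)\,d\nu^1_x[\mu](v)\,d\mu(x).$$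 The operation $\oplus_f$ defines an abelian monoid structure on the set of PVFs, with neutral element $\mu\mapsto\mu\otimes\delta_0$. $\mathrm{Vec}(\mathbb{R}^n)$ is the set of locally Lipschitz vector fields $v:\mathbb{R}^n\to\mathbb{R}^n$ with sublinear growth ($|v(x)|\le C(1+|x|)$ for some $C>0$), endowed with the usual vector space structure. $\mathrm{PVec}(\mathbb{R}^n)$ is the set, endowed with the operations $\oplus_f$ and $\cdot_f$, of PVFs $V$ such that: (1) there is $C>0$ with $\sup_{(x,v)\in \mathrm{Supp}(V[\mu])}|v|\le C(1+\sup_{x\in \mathrm{Supp}(\mu)}|x|)$ for every $\mu\in\mathcal{P}_c(\mathbb{R}^n)$; (2) for every $R>0$ there is $K=K(R)>0$ such that $\mathcal{W}(V[\mu],V[\nu])\le K\,W(\mu,\nu)$ whenever $\mathrm{Supp}(\mu),\mathrm{Supp}(\nu)\subset B(0,R)$, the ball of radius $R$ centered at $0$. Here $W$ is the 1-Wasserstein metric on $\mathbb{R}^n$ and, for $V_1,V_2\in\mathcal{P}_c(T\mathbb{R}^n)$ with base marginals $\mu_i=\pi_1\#V_i$, $\mathcal{W}(V_1,V_2)$ is the infimum of $\int|v-w|\,dT(x,v,y,w)$ over couplings $T$ of $V_1,V_2$ such that $\pi_{13}\#T$ is an optimal coupling of $\mu_1,\mu_2$ for the cost $|x-y|$.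
   Formalization: ''Isomorphism from Vec to PVec'' is proved as an injective monoid homomorphism into PVec (isomorphism onto its image); surjectivity is omitted, being false for n≥1: V[μ]=μ⊗(δ_e+δ_{-e})/2, e≠0, lies in PVec but is no V^v. *)

(* Defs.v *)
From HB Require Import structures.
From mathcomp Require Import all_boot all_order all_algebra.
From mathcomp Require Import all_classical all_reals all_analysis.
From mathcomp Require Import measurable_realfun giry ring lra.

Set Implicit Arguments.
Unset Strict Implicit.
Unset Printing Implicit Defensive.
Import Order.TTheory GRing.Theory Num.Theory.
Import numFieldNormedType.Exports.

Local Open Scope classical_set_scope.
Local Open Scope ring_scope.

(* The norm that mathcomp-analysis puts on matrices is the sup norm; it is used
   below only through the topology that it induces. *)
Definition enorm (R : realType) (n : nat) (x : 'rV[R]_n) : R :=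
  Num.sqrt (\sum_(i < n) x ord0 i ^+ 2).

Section enorm_theory.
Context (R : realType) (n : nat).
Implicit Types x y : 'rV[R]_n.

Lemma enorm_ge0 x : 0 <= enorm x.
Proof. exact: sqrtr_ge0. Qed.

Lemma enormE x : enorm x ^+ 2 = \sum_(i < n) x ord0 i ^+ 2.
Proof. by rewrite sqr_sqrtr// sumr_ge0// => i _; exact: sqr_ge0. Qed.

Lemma ler_coord_enorm x i : `|x ord0 i| <= enorm x.
Proof.
rewrite -sqrtr_sqr ler_wsqrtr// (bigD1 i)//= lerDl.
by rewrite sumr_ge0// => j _; exact: sqr_ge0.
Qed.

Lemma enorm0 : enorm (0 : 'rV[R]_n) = 0.
Proof.
by rewrite /enorm big1 ?sqrtr0// => i _; rewrite mxE expr0n.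
Qed.

Lemma enormZ (a : R) x : enorm (a *: x) = `|a| * enorm x.
Proof.
rewrite /enorm -sqrtr_sqr -sqrtrM ?sqr_ge0// mulr_sumr.
by congr Num.sqrt; apply: eq_bigr => i _; rewrite mxE exprMn.
Qed.

Lemma dot_le_enorm x y : \sum_(i < n) x ord0 i * y ord0 i <= enorm x * enorm y.
Proof.
have coord0 (z : 'rV[R]_n) : enorm z = 0 -> forall i, z ord0 i = 0.
  move=> z0 i; apply/eqP; rewrite -normr_le0.
  by rewrite (le_trans (ler_coord_enorm z i))// z0.
have [x0|xn0] := eqVneq (enorm x) 0.
  by rewrite x0 mul0r big1// => i _; rewrite coord0// mul0r.
have [y0|yn0] := eqVneq (enorm y) 0.
  by rewrite y0 mulr0 big1// => i _; rewrite [y _ _]coord0// mulr0.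
have x_gt0 : 0 < enorm x by rewrite lt_def xn0 enorm_ge0.
have y_gt0 : 0 < enorm y by rewrite lt_def yn0 enorm_ge0.
have : 0 <= \sum_(i < n) (enorm y * x ord0 i - enorm x * y ord0 i) ^+ 2.
  by rewrite sumr_ge0// => i _; exact: sqr_ge0.
under eq_bigr do rewrite sqrrB !exprMn.
rewrite big_split sumrB/= -!mulr_sumr -!enormE.
have -> : \sum_(i < n) enorm y * x ord0 i * (enorm x * y ord0 i) *+ 2 =
    (enorm x * enorm y) * (\sum_(i < n) x ord0 i * y ord0 i) *+ 2.
  by rewrite mulr_sumr -sumrMnl; apply: eq_bigr => i _; congr (_ *+ 2); ring.
have : 0 < enorm x * enorm y by rewrite mulr_gt0.
by nra.
Qed.

Lemma ler_enormD x y : enorm (x + y) <= enorm x + enorm y.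
Proof.
rewrite -ler_sqr ?nnegrE ?addr_ge0 ?enorm_ge0//.
rewrite enormE; under eq_bigr do rewrite mxE sqrrD.
rewrite 2!big_split/= sqrrD -!enormE lerD2r lerD2l sumrMnl lerMn2r/=.
exact: dot_le_enorm.
Qed.

Lemma ler_enorm_norm x : enorm x <= Num.sqrt n%:R * `|x|.
Proof.
rewrite -[X in _ * X]ger0_norm// -sqrtr_sqr -sqrtrM// ler_wsqrtr//.
apply: (@le_trans _ _ (\sum_(i < n) `|x| ^+ 2)).
  apply: ler_sum => i _; rewrite -(real_normK (num_real (x _ _))).
  rewrite lerXn2r ?nnegrE// [leRHS]/Num.Def.normr/= mx_normrE.
  by apply/bigmax_geP; right => /=; exists (ord0, i).
by rewrite sumr_const card_ord mulr_natl.
Qed.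

End enorm_theory.

Definition open_mx (R : realType) (m n : nat) : set (set 'M[R]_(m, n)) :=
  [set U | open U].
Arguments open_mx : clear implicits.

(* Borel sigma-algebra. As 'rV[R]_n is second countable, the product
   sigma-algebra of the library on 'rV[R]_n * 'rV[R]_n is the Borel one. *)
HB.instance Definition _ (R : realType) (m n : nat) :=
  @isMeasurable.Build (sigma_display (open_mx R m n)) 'M[R]_(m, n)
    <<s open_mx R m n >>
    (@sigma_algebra0 _ setT (open_mx R m n)) (@sigma_algebraC _ (open_mx R m n))
    (@sigma_algebra_bigcup _ setT (open_mx R m n)).


Section borel_rV.
Context (R : realType) (n : nat).

Lemma measurable_open_rV (U : set 'rV[R]_n) : open U -> measurable U.
Proof. by move=> oU; exact: sub_sigma_algebra. Qed.

Lemma measurable_fun_rV d (T : measurableType d) (f : T -> 'rV[R]_n) :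
  (forall i, measurable_fun setT (fun x => f x ord0 i)) ->
  measurable_fun setT f.
Proof.
move=> mf; apply: (measurability (open_mx R 1 n)) => //.
move=> _ [U oU <-]; rewrite setTI.
pose box (c : 'rV[rat]_n * nat) : set 'rV[R]_n :=
  [set y | forall i, `|y ord0 i - ratr (c.1 ord0 i)| < c.2.+1%:R^-1].
pose V c := if `[< box c `<=` U >] then box c else set0.
have -> : f @^-1` U = \bigcup_c f @^-1` V c.
  rewrite -preimage_bigcup; congr (_ @^-1` _); apply/seteqP; split=> y.
    move=> Uy; have /nbhs_ballP[e /= e0 yeU] : nbhs y U by exact: open_nbhs_nbhs.
    have [k /= ke] : exists k : nat, k.+1%:R^-1 < e / 2.
      exists (Num.truncn (e / 2)^-1).
      by rewrite invf_plt ?posrE ?divr_gt0// truncnS_gt.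
    have qP i : exists q : rat, `|y ord0 i - ratr q| < k.+1%:R^-1 :> R.
      have /rat_in_itvoo[q /itvP yq] :
          y ord0 i - k.+1%:R^-1 < y ord0 i + k.+1%:R^-1 :> R.
        by rewrite ltrBlDr -addrA ltrDl addr_gt0// invr_gt0.
      by exists q; rewrite ltr_distlC !yq.
    pose c : 'rV[rat]_n := \row_i projT1 (cid (qP i)).
    exists (c, k) => //; rewrite /V asboolT; last first.
      move=> z zc; apply: yeU; split=> // i j; rewrite (ord1 i).
      rewrite /ball/= -(subrKA (ratr (c ord0 j))) (splitr e).
      rewrite (le_lt_trans (ler_normD _ _))// ltrD//.
        by rewrite (lt_trans _ ke)// mxE; case: cid.
      by rewrite distrC (lt_trans (zc j)).
    by move=> i; rewrite /= mxE; case: cid.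
  by move=> [c _]; rewrite /V; case: asboolP => // /[apply].
apply: countable_bigcupT_measurable => [|c]; first exact: countableP.
rewrite /V; case: asboolP => _; last by rewrite preimage_set0.
have -> : f @^-1` box c = \bigcap_(i in [set: 'I_n])
    (fun x => f x ord0 i) @^-1` ball (ratr (c.1 ord0 i) : R) c.2.+1%:R^-1.
  apply/seteqP; split=> x /= H i.
    by move=> _; rewrite /ball/= distrC.
  by have := H i Logic.I; rewrite /ball/= distrC.
apply: fin_bigcap_measurable => // i _; rewrite -[X in measurable X]setTI.
by apply: mf => //; apply: open_measurable; exact: ball_open.
Qed.

Lemma measurable_coord (i : 'I_n) :
  measurable_fun setT (fun x : 'rV[R]_n => x ord0 i).
Proof.
apply: (measurability _ (RGenOInfty.measurableE R)).
move=> _ [_ [a ->] <-]; rewrite setTI; apply: measurable_open_rV.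
have ci : continuous (fun x : 'rV[R]_n => x ord0 i).
  move=> x A /nbhs_ballP[e /= e0 xA]; apply/nbhs_ballP.
  by exists e => //= y [_ xy]; apply: xA.
by move/continuousP : ci; apply; exact: rray_open.
Qed.

Lemma continuous_measurable_rV m (f : 'rV[R]_n -> 'rV[R]_m) :
  continuous f -> measurable_fun setT f.
Proof.
move=> /continuousP cf; apply: (measurability (open_mx R 1 m)) => //.
by move=> _ [U oU <-]; rewrite setTI; apply: measurable_open_rV; exact: cf.
Qed.

Lemma measurable_addrV :
  measurable_fun setT (fun p : 'rV[R]_n * 'rV[R]_n => p.1 + p.2).
Proof.
apply: measurable_fun_rV => i; under eq_fun do rewrite mxE.
by apply: measurable_funD; apply: measurableT_comp (measurable_coord i) _.
Qed.

Lemma measurable_scalerV (a : R) :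
  measurable_fun setT (fun x : 'rV[R]_n => a *: x).
Proof.
apply: measurable_fun_rV => i; under eq_fun do rewrite mxE.
by apply: measurable_funM => //; exact: measurable_coord.
Qed.

End borel_rV.

Section vec.
Context (R : realType) (n : nat).
Local Notation E := 'rV[R]_n.
Implicit Types v w : E -> E.

Definition locally_lipschitz v := forall x : E, exists2 U : set E, nbhs x U &
  exists L : R, forall y z, U y -> U z -> enorm (v y - v z) <= L * enorm (y - z).

Definition sublinear_growth v :=
  exists2 C : R, 0 < C & forall x, enorm (v x) <= C * (1 + enorm x).

Definition vec_pred : {pred E -> E} :=
  fun v => `[< locally_lipschitz v /\ sublinear_growth v >].

Lemma vec_submod_closed : submod_closed vec_pred.
Proof.
split=> [|a v w].
  apply/asboolP; split=> [x|].
    exists setT; first exact: filterT.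
    by exists 0 => y z _ _; rewrite mul0r subrr enorm0.
  by exists 1 => // x; rewrite enorm0 mul1r addr_ge0// enorm_ge0.
move=> /asboolP[lv [C C0 vC]] /asboolP[lw [D D0 wD]].
apply/asboolP; split=> [x|].
  have [U xU [K vK]] := lv x; have [V xV [L wL]] := lw x.
  exists (U `&` V); first exact: filterI.
  exists (`|a| * K + L) => y z [Uy Vy] [Uz Vz].
  have -> : (a *: v + w) y - (a *: v + w) z = a *: (v y - v z) + (w y - w z).
    by rewrite scalerBr opprD addrACA.
  rewrite (le_trans (ler_enormD _ _))// enormZ mulrDl -mulrA lerD//.
    by rewrite ler_wpM2l// vK.
  exact: wL.
exists (`|a| * C + D); first by rewrite ltr_wpDl// mulr_ge0// ltW.
move=> x; rewrite (le_trans (ler_enormD _ _))// enormZ mulrDl -mulrA lerD//.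
by rewrite ler_wpM2l.
Qed.

HB.instance Definition _ := GRing.isSubmodClosed.Build R (E -> E) vec_pred
  vec_submod_closed.

Record vec := Vec { vec_fun :> E -> E; _ : vec_fun \in vec_pred }.
HB.instance Definition _ := [isSub for vec_fun].
HB.instance Definition _ := [Choice of vec by <:].
HB.instance Definition _ := [SubChoice_isSubLmodule of vec by <:].

Lemma vecP (v : vec) : locally_lipschitz v /\ sublinear_growth v.
Proof. by case: v => v /= /asboolP. Qed.

Lemma measurable_vec (v : vec) : measurable_fun setT v.
Proof.
apply: continuous_measurable_rV => x.
have [/(_ x)[U xU [L vL]] _] := vecP v.
have [C C0 vC] : exists2 C, 0 < C & forall y, U y -> `|v y - v x| <= C * `|y - x|.
  exists (`|L| * Num.sqrt n%:R + 1).
    by rewrite ltr_wpDl// mulr_ge0// sqrtr_ge0.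
  move=> y Uy; have sup_le (z : E) : `|z| <= enorm z.
    rewrite {1}/Num.Def.normr/= mx_normrE; apply/bigmax_leP; split=> [|[i j] _/=].
      exact: enorm_ge0.
    by rewrite (ord1 i); exact: ler_coord_enorm.
  rewrite (le_trans (sup_le _))// (le_trans (vL _ _ Uy (nbhs_singleton xU)))//.
  rewrite mulrDl mul1r ler_wpDr// (@le_trans _ _ (`|L| * enorm (y - x)))//.
    by rewrite ler_wpM2r// ?enorm_ge0// ler_norm.
  by rewrite -mulrA ler_wpM2l// ler_enorm_norm.
move=> A /nbhs_ballP[e /= e0 vA]; have /nbhs_ballP[r /= r0 xrU] := xU.
apply/nbhs_ballP; exists (Num.min r (e / C)) => /=.
  by rewrite lt_min r0 divr_gt0.
move=> y xy; apply: vA; move: (xy); rewrite -!ball_normE/= => {}xy.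
have Uy : U y.
  by apply: xrU; rewrite -ball_normE/= (lt_le_trans xy)// ge_min lexx.
rewrite distrC (le_lt_trans (vC _ Uy))// mulrC -ltr_pdivlMr// distrC.
by rewrite (lt_le_trans xy)// ge_min lexx orbT.
Qed.

End vec.
Arguments vec : clear implicits.

Section mixture.
Local Open Scope ereal_scope.
Context d d' (X : measurableType d) (Z : measurableType d') (R : realType).
Variables (m : {measure set X -> \bar R}) (g : X -> set Z -> \bar R).
Hypothesis g_ge0 : forall x B, 0 <= g x B.
Hypothesis mg : forall B, measurable B -> measurable_fun setT (g ^~ B).
Hypothesis g_additive : forall x, semi_sigma_additive (g x).

Lemma mixture_additive : semi_sigma_additive (fun B => \int[m]_x g x B).
Proof.
move=> F mF tF mUF.
have -> : \int[m]_x g x (\bigcup_i F i) = \sum_(i <oo) \int[m]_x g x (F i).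
  rewrite -integral_nneseries//; last by move=> i; exact: mg.
  by apply: eq_integral => x _; apply/esym/cvg_lim => //; exact: g_additive.
by apply: is_cvg_nneseries => i _ _; exact: integral_ge0.
Qed.

End mixture.

Section kernel_fst.
Context d1 d2 d3 (X : measurableType d1) (Y : measurableType d2)
  (Z : measurableType d3) (R : realType) (k : R.-pker X ~> Z).

Definition kernel_fst : X * Y -> {measure set Z -> \bar R} := k \o fst.

Let measurable_kernel_fst U :
  measurable U -> measurable_fun setT (kernel_fst ^~ U).
Proof.
by move=> mU; apply: (measurableT_comp (measurable_kernel k _ mU)).
Qed.

HB.instance Definition _ :=
  isKernel.Build _ _ _ _ _ kernel_fst measurable_kernel_fst.

Let kernel_fst_prob x : kernel_fst x setT = 1%E.
Proof. exact: prob_kernel. Qed.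

HB.instance Definition _ :=
  Kernel_isProbability.Build _ _ _ _ _ kernel_fst kernel_fst_prob.

End kernel_fst.

Section kernel_push.
Local Open Scope ereal_scope.
Context d1 d2 d3 (X : measurableType d1) (Y : measurableType d2)
  (Z : measurableType d3) (R : realType).
Variables (mu : probability X R) (h : X * Y -> Z) (mh : measurable_fun setT h).
Variable nu : R.-pker X ~> Y.

Definition kpush (B : set Z) : \bar R := \int[mu]_x \int[nu x]_y (\1_B (h (x, y)))%:E.

Let mh1 B : measurable B ->
  measurable_fun setT (fun p : X * Y => (\1_B (h p))%:E : \bar R).
Proof.
by move=> mB; apply/measurable_EFinP; apply: measurableT_comp => //.
Qed.

Lemma measurable_kpush B : measurable B ->
  measurable_fun setT (fun x => \int[nu x]_y (\1_B (h (x, y)))%:E).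
Proof.
move=> mB; apply: (measurable_fun_integral_finite_kernel
  (fun p : X * Y => (\1_B (h p))%:E)) => //.
exact: mh1.
Qed.

Let in0 (x : X) : \int[nu x]_y (\1_(set0 : set Z) (h (x, y)))%:E = 0 :> \bar R.
Proof. by apply: integral0_eq => y _; rewrite indic0. Qed.

Let in_ge0 (x : X) (B : set Z) : 0 <= \int[nu x]_y (\1_B (h (x, y)))%:E.
Proof. by apply: integral_ge0 => y _; rewrite lee_fin. Qed.

Lemma kpush_additive : semi_sigma_additive kpush.
Proof.
apply: mixture_additive => //; first exact: measurable_kpush.
move=> x; apply: (@mixture_additive _ _ _ _ _ _ (fun y => dirac (h (x, y)))).
- by move=> y B; exact: measure_ge0.
- move=> B mB; apply: (@measurableT_comp _ _ _ _ _ _ _ _ (pair x) (mh1 mB)).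
  exact: pair1_measurable.
- by move=> y; exact: measure_semi_sigma_additive.
Qed.

Lemma kpush0 : kpush set0 = 0. Proof. by apply: integral0_eq => x _; exact: in0. Qed.

Lemma kpush_ge0 B : 0 <= kpush B.
Proof. by apply: integral_ge0. Qed.

Lemma kpushT : kpush setT = 1.
Proof.
rewrite /kpush (eq_integral (cst 1)) => [|x _].
  by rewrite integral_cst// mul1e; exact: probability_setT.
rewrite (eq_integral (cst 1)) => [|y _]; last by rewrite indicT.
by rewrite integral_cst// mul1e; exact: prob_kernel.
Qed.

End kernel_push.

(* A measure of mathcomp-analysis is a function on all the subsets of its
   carrier and its values on nonmeasurable sets carry no information: measures
   are therefore compared with _ ≡μ _ (equality on measurable sets) instead
   of Leibniz equality. *)
Section pvf.
Local Open Scope ereal_scope.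
Context (R : realType) (n : nat).
Local Notation E := 'rV[R]_n.
Local Notation TE := (E * E)%type.

Definition pi1 (p : TE) : E := p.1.

Lemma measurable_pi1 : measurable_fun setT pi1.
Proof. exact: measurable_fst. Qed.

HB.instance Definition _ := isMeasurableFun.Build _ _ _ _ pi1 measurable_pi1.

Section tensor.
Variables (mu : probability E R) (nu : R.-pker E ~> E).

Definition tensor (B : set TE) : \bar R :=
  \int[mu]_x \int[nu x]_v (\1_B (x, v))%:E.

Let mid : measurable_fun setT (@id TE). Proof. exact: measurable_id. Qed.

HB.instance Definition _ := isMeasure.Build _ _ _ tensor
  (kpush0 mu id nu) (kpush_ge0 mu id nu) (@kpush_additive _ _ _ _ _ _ _ mu _ mid nu).
HB.instance Definition _ := Measure_isProbability.Build _ _ _ tensor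
  (kpushT mu id nu).

End tensor.

Section fiber_scale_measure.
Variables (a : R) (mu : probability E R) (nu : R.-pker E ~> E).

Definition fiber_scale_measure (B : set TE) : \bar R :=
  \int[mu]_x \int[nu x]_v (\1_B (x, a *: v)%R)%:E.

Let h (p : TE) : TE := (p.1, a *: p.2)%R.

Let mh : measurable_fun setT h.
Proof.
apply/measurable_fun_pairP; split; first exact: measurable_fst.
exact: measurableT_comp (measurable_scalerV a) measurable_snd.
Qed.

HB.instance Definition _ := isMeasure.Build _ _ _ fiber_scale_measure
  (kpush0 mu h nu) (kpush_ge0 mu h nu) (@kpush_additive _ _ _ _ _ _ _ mu _ mh nu).
HB.instance Definition _ := Measure_isProbability.Build _ _ _
  fiber_scale_measure (kpushT mu h nu).

End fiber_scale_measure.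

Section fiber_add_measure.
Variables (mu : probability E R) (nu1 nu2 : R.-pker E ~> E).

Definition fiber_add_measure (B : set TE) : \bar R :=
  \int[mu]_x \int[nu1 x]_v \int[nu2 x]_w (\1_B (x, v + w)%R)%:E.

Let g (p : TE) (B : set TE) : \bar R :=
  \int[nu2 p.1]_w (\1_B (p.1, p.2 + w)%R)%:E.

Let h (q : TE * E) : TE := (q.1.1, q.1.2 + q.2)%R.

Let mh : measurable_fun setT h.
Proof.
apply/measurable_fun_pairP; split.
  exact: (measurableT_comp measurable_fst measurable_fst).
apply: (measurableT_comp (@measurable_addrV R n)
  (_ : measurable_fun setT (fun q : TE * E => (q.1.2, q.2)))).
apply/measurable_fun_pairP; split; last exact: measurable_snd.
exact: (measurableT_comp measurable_snd measurable_fst).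
Qed.

Let g_ge0 p B : 0 <= g p B.
Proof. by apply: integral_ge0 => w _; rewrite lee_fin. Qed.

Let mg B : measurable B -> measurable_fun setT (g ^~ B).
Proof. exact: (measurable_kpush mh (kernel_fst nu2)). Qed.

Let g_additive p : semi_sigma_additive (g p).
Proof.
apply: (@mixture_additive _ _ _ _ _ _ (fun w => dirac (h (p, w)))).
- by move=> w B; exact: measure_ge0.
- move=> B mB; apply/measurable_EFinP; apply: (measurableT_comp _ (_ :
    measurable_fun setT (fun w => h (p, w)))) => //.
  exact: (measurableT_comp mh (pair1_measurable p)).
- by move=> w; exact: measure_semi_sigma_additive.
Qed.

Let fiber_add_measure0 : fiber_add_measure set0 = 0.
Proof.
apply: integral0_eq => x _; apply: integral0_eq => v _.
by apply: integral0_eq => w _; rewrite indic0.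
Qed.

Let fiber_add_measure_ge0 B : 0 <= fiber_add_measure B.
Proof.
apply: integral_ge0 => x _; apply: integral_ge0 => v _.
exact: (g_ge0 (x, v) B).
Qed.

Let fiber_add_measure_additive : semi_sigma_additive fiber_add_measure.
Proof.
apply: mixture_additive.
- by move=> x B; apply: integral_ge0 => v _; exact: (g_ge0 (x, v) B).
- move=> B mB; apply: (measurable_fun_integral_finite_kernel (g ^~ B) nu1).
  - by move=> p; exact: g_ge0.
  - exact: mg.
- move=> x; apply: (@mixture_additive _ _ _ _ _ _ (fun v => g (x, v))) => //.
  by move=> B mB; exact: (measurableT_comp (mg mB) (pair1_measurable x)).
Qed.

HB.instance Definition _ := isMeasure.Build _ _ _ fiber_add_measure
  fiber_add_measure0 fiber_add_measure_ge0 fiber_add_measure_additive.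

Let fiber_add_measureT : fiber_add_measure setT = 1.
Proof.
rewrite /fiber_add_measure (eq_integral (cst 1)) => [|x _].
  by rewrite integral_cst// mul1e; exact: probability_setT.
rewrite (eq_integral (cst 1)) => [|v _].
  by rewrite integral_cst// mul1e; exact: prob_kernel.
rewrite (eq_integral (cst 1)) => [|w _]; last by rewrite indicT.
by rewrite integral_cst// mul1e; exact: prob_kernel.
Qed.

HB.instance Definition _ := Measure_isProbability.Build _ _ _
  fiber_add_measure fiber_add_measureT.

End fiber_add_measure.

Record pvf := PVF {
  pvf_fun :> probability E R -> probability TE R ;
  pvf_ext : forall mu mu' : probability E R,
    mu ≡μ mu' -> pvf_fun mu ≡μ pvf_fun mu' ;
  pvf_marginal : forall mu : probability E R,
    distribution (pvf_fun mu) pi1 ≡μ mu }.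

Definition pvf_eq (V W : pvf) := forall mu : probability E R, V mu ≡μ W mu.

Section pvf_lemmas.
Implicit Types (mu : probability E R) (nu : R.-pker E ~> E).

Lemma tensor_ext mu mu' nu : mu ≡μ mu' -> tensor mu nu ≡μ tensor mu' nu.
Proof. by move=> mumu' B mB; apply: eq_measure_integral => A mA _; exact: mumu'. Qed.

Lemma fiber_add_measure_ext mu mu' nu1 nu2 : mu ≡μ mu' ->
  fiber_add_measure mu nu1 nu2 ≡μ fiber_add_measure mu' nu1 nu2.
Proof. by move=> mumu' B mB; apply: eq_measure_integral => A mA _; exact: mumu'. Qed.

Lemma fiber_scale_measure_ext (a : R) mu mu' nu : mu ≡μ mu' ->
  fiber_scale_measure a mu nu ≡μ fiber_scale_measure a mu' nu.
Proof. by move=> mumu' B mB; apply: eq_measure_integral => A mA _; exact: mumu'. Qed.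

Lemma integral_prob_cst d (T : measurableType d) (m : {measure set T -> \bar R})
  (r : R) : m setT = 1 -> \int[m]__ r%:E = r%:E.
Proof. by move=> m1; rewrite integral_cst// m1 mule1. Qed.

Lemma tensor_marginal mu nu : distribution (tensor mu nu) pi1 ≡μ mu.
Proof.
move=> A mA; transitivity (\int[mu]_x (\1_A x)%:E); last by rewrite integral_indic// setIT.
apply: eq_integral => x _.
by apply: etrans (integral_prob_cst (\1_A x) (@prob_kernel _ _ _ _ _ nu x)); exact: eq_integral.
Qed.

Lemma fiber_scale_measure_marginal (a : R) mu nu :
  distribution (fiber_scale_measure a mu nu) pi1 ≡μ mu.
Proof.
move=> A mA; transitivity (\int[mu]_x (\1_A x)%:E); last by rewrite integral_indic// setIT.
apply: eq_integral => x _.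
by apply: etrans (integral_prob_cst (\1_A x) (@prob_kernel _ _ _ _ _ nu x)); exact: eq_integral.
Qed.

Lemma fiber_add_measure_marginal mu nu1 nu2 :
  distribution (fiber_add_measure mu nu1 nu2) pi1 ≡μ mu.
Proof.
move=> A mA; transitivity (\int[mu]_x (\1_A x)%:E); last by rewrite integral_indic// setIT.
apply: eq_integral => x _.
apply: etrans (integral_prob_cst (\1_A x) (@prob_kernel _ _ _ _ _ nu1 x)).
apply: eq_integral => v _.
by apply: etrans (integral_prob_cst (\1_A x) (@prob_kernel _ _ _ _ _ nu2 x)); exact: eq_integral.
Qed.

End pvf_lemmas.

Definition pvf_of_kernel (nu : R.-pker E ~> E) : pvf :=
  @PVF (fun mu => tensor mu nu) (fun mu mu' => @tensor_ext mu mu' nu)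
    (fun mu => tensor_marginal mu nu).

Definition dirac_pvf (v : vec R n) : pvf :=
  pvf_of_kernel (kdirac (measurable_vec v)).

Definition kdirac0 : R.-pker E ~> E := kdirac (measurable_cst (0 : E)%R).

Definition zero_pvf : pvf := pvf_of_kernel kdirac0.

Definition is_disintegration (mu : probability E R) (P : probability TE R)
  (nu : R.-pker E ~> E) := P ≡μ tensor mu nu.

(* By the disintegration theorem every probability measure P on TE with first
   marginal mu has a disintegration, unique up to a mu-null set of base points,
   so the default value kdirac0 is never used when P = V mu for a PVF V, and
   the two operations below do not depend on the choice. *)
Definition pick_kernel (D : R.-pker E ~> E -> Prop) : R.-pker E ~> E :=
  match pselect (exists nu, D nu) with
  | left exD => projT1 (cid exD)
  | right _ => kdirac0
  end.

Definition disintegration (mu : probability E R) (P : probability TE R) :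
  R.-pker E ~> E := pick_kernel (is_disintegration mu P).

Lemma disintegration_ext (mu mu' : probability E R) (P P' : probability TE R) :
  mu ≡μ mu' -> P ≡μ P' -> disintegration mu P = disintegration mu' P'.
Proof.
move=> mumu' PP'; congr pick_kernel; apply/funext => nu; apply/propext.
by split=> D B mB; [rewrite -PP'// -(tensor_ext nu mumu')// D|
  rewrite PP'// (tensor_ext nu mumu')// D].
Qed.

Section fiber_operations.
Variables (a : R) (V W : pvf).

Definition fiber_add_fun (mu : probability E R) : probability TE R :=
  fiber_add_measure mu (disintegration mu (V mu)) (disintegration mu (W mu)).

Lemma fiber_add_ext (mu mu' : probability E R) :
  mu ≡μ mu' -> fiber_add_fun mu ≡μ fiber_add_fun mu'.
Proof.
move=> mumu'; rewrite /fiber_add_fun.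
rewrite (disintegration_ext mumu' (pvf_ext V mumu')).
rewrite (disintegration_ext mumu' (pvf_ext W mumu')).
exact: fiber_add_measure_ext.
Qed.

Definition fiber_add : pvf :=
  @PVF fiber_add_fun fiber_add_ext
    (fun mu => @fiber_add_measure_marginal mu _ _).

Definition fiber_scale_fun (mu : probability E R) : probability TE R :=
  fiber_scale_measure a mu (disintegration mu (V mu)).

Lemma fiber_scale_ext (mu mu' : probability E R) :
  mu ≡μ mu' -> fiber_scale_fun mu ≡μ fiber_scale_fun mu'.
Proof.
move=> mumu'; rewrite /fiber_scale_fun.
rewrite (disintegration_ext mumu' (pvf_ext V mumu')).
exact: fiber_scale_measure_ext.
Qed.

Definition fiber_scale : pvf :=
  @PVF fiber_scale_fun fiber_scale_ext
    (fun mu => @fiber_scale_measure_marginal a mu _).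

End fiber_operations.

End pvf.
Arguments pvf : clear implicits.
Arguments zero_pvf {R n}.

Section coupling.
Context d1 d2 (X : measurableType d1) (Y : measurableType d2) (R : realType).

Definition is_coupling (P : probability X R) (Q : probability Y R)
    (T : probability (X * Y)%type R) :=
  (forall A, measurable A -> T (fst @^-1` A) = P A) /\
  (forall B, measurable B -> T (snd @^-1` B) = Q B).

End coupling.

Section wasserstein.
Local Open Scope ereal_scope.
Context (R : realType) (n : nat).
Local Notation E := 'rV[R]_n.
Local Notation TE := (E * E)%type.

Definition transport_cost (T : probability (E * E)%type R) : \bar R :=
  \int[T]_p (enorm (p.1 - p.2)%R)%:E.

Definition wasserstein (mu nu : probability E R) : \bar R :=
  ereal_inf [set transport_cost T | T in is_coupling mu nu].

Definition is_optimal_coupling (mu nu : probability E R)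
    (T : probability (E * E)%type R) :=
  is_coupling mu nu T /\
  forall S, is_coupling mu nu S -> transport_cost T <= transport_cost S.

Definition pi13 (z : TE * TE) : E * E := (z.1.1, z.2.1).

Lemma measurable_pi13 : measurable_fun setT pi13.
Proof.
apply/measurable_fun_pairP; split.
  exact: (measurableT_comp measurable_fst measurable_fst).
exact: (measurableT_comp measurable_fst measurable_snd).
Qed.

HB.instance Definition _ := isMeasurableFun.Build _ _ _ _ pi13 measurable_pi13.

Definition fiber_wasserstein (P Q : probability TE R) : \bar R :=
  ereal_inf [set \int[T]_z (enorm (z.1.2 - z.2.2)%R)%:E |
    T in [set T : probability (TE * TE)%type R | is_coupling P Q T /\
      is_optimal_coupling (distribution P (@pi1 R n)) (distribution Q (@pi1 R n))
        (distribution T pi13)]].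

End wasserstein.

Definition supp (T : topologicalType) (R : realType) (m : set T -> \bar R) :
  set T := [set x | forall U, open U -> U x -> (0 < m U)%E].

Section pvec.
Local Open Scope ereal_scope.
Context (R : realType) (n : nat).
Local Notation E := 'rV[R]_n.
Implicit Types (V : pvf R n) (mu nu : probability E R).

(* The suprema are taken in \bar R because the supremum of an unbounded set of
   reals is 0 in the library. *)
Definition sublinear_pvf V :=
  exists2 C : R, (0 < C)%R & forall mu, compact (supp mu) ->
    ereal_sup [set (enorm p.2)%:E | p in supp (V mu)] <=
    C%:E * (1 + ereal_sup [set (enorm x)%:E | x in supp mu]).

Definition lipschitz_pvf V :=
  forall r : R, (0 < r)%R -> exists2 K : R, (0 < K)%R & forall mu nu,
    supp mu `<=` [set x | (enorm x < r)%R] ->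
    supp nu `<=` [set x | (enorm x < r)%R] ->
    fiber_wasserstein (V mu) (V nu) <= K%:E * wasserstein mu nu.

Definition PVec : set (pvf R n) :=
  [set V | sublinear_pvf V /\ lipschitz_pvf V].

End pvec.

(* Main.v *)
(* The only part of the statement that is not a computation with the measures
   mu (x) delta_(v x) is the Lipschitz estimate: pushing an optimal coupling of
   mu and nu forward by (x, y) |-> ((x, v x), (y, v y)) gives an admissible
   coupling of cost at most Lip(v) W(mu, nu), provided that an optimal coupling
   exists.

   Existence is proved by weak compactness. Take couplings T_k of cost tending
   to the infimum and an ultrafilter U on nat finer than the cofinite one, and
   code a point of the cube [-r, r]^d by the bits of the signed dyadic
   expansions of its coordinates. For every finite word s of bits let p(s) be
   the limit along U of the T_k-mass of the points whose code starts with s.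
   Then p is additive, and nested intervals of lengths p(s) define random bits
   on the probability space [0, 1] with these masses; the law of the point
   that they code is the weak limit of the T_k. Lipschitz functions determine
   the marginals, and the cost is Lipschitz.

   For the two fiber operations, a disintegration of a measure carried by the
   graph of v is almost everywhere a Dirac mass. *)

Require Import Defs.
From mathcomp Require Import all_boot all_order all_algebra.
From mathcomp Require Import all_classical all_reals all_analysis.
From mathcomp Require Import measurable_realfun giry ring lra.

Set Implicit Arguments.
Unset Strict Implicit.
Unset Printing Implicit Defensive.
Import Order.TTheory GRing.Theory Num.Theory.
Import numFieldNormedType.Exports.

Local Open Scope classical_set_scope.
Local Open Scope ring_scope.

(** * Measures carried by graphs *)

Section deterministic_fibers.
Local Open Scope ereal_scope.
Context (R : realType) (n : nat).
Local Notation E := 'rV[R]_n.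
Local Notation TE := (E * E)%type.
Implicit Types (mu : probability E R) (nu : R.-pker E ~> E).

Lemma integral_kdirac (f : E -> E) (mf : measurable_fun setT f) x
    (h : E -> \bar R) :
  measurable_fun setT h -> \int[kdirac mf x]_y h y = h (f x).
Proof. by move=> mh; rewrite integral_dirac// diracT mul1e. Qed.

Lemma measurable_indic_pair d (T : measurableType d) (B : set T) (h : E -> T) :
  measurable B -> measurable_fun setT h ->
  measurable_fun setT (fun v => (\1_B (h v))%:E : \bar R).
Proof. by move=> mB mh; apply/measurable_EFinP; apply: measurableT_comp. Qed.

Lemma measurable_graph_map (f : E -> E) : measurable_fun setT f ->
  measurable_fun setT (fun x => (x, f x)).
Proof. by move=> mf; exact: measurable_fun_pair. Qed.

Lemma tensor_kdirac mu (f : E -> E) (mf : measurable_fun setT f) B :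
  measurable B ->
  tensor mu (kdirac mf) B = \int[mu]_x (\1_B (x, f x))%:E.
Proof.
move=> mB; apply: eq_integral => x _; rewrite integral_kdirac//.
exact: (measurable_indic_pair mB (pair1_measurable x)).
Qed.

Lemma measurable_eqV d (T : measurableType d) (f g : T -> E) :
  measurable_fun setT f -> measurable_fun setT g ->
  measurable [set t | f t = g t].
Proof.
move=> mf mg; have -> : [set t | f t = g t] =
    \bigcap_(i in [set: 'I_n]) [set t | f t ord0 i == g t ord0 i].
  apply/seteqP; split=> t /= => [fg i _|fg]; first by rewrite /= fg.
  by apply/rowP => i; apply/eqP; exact: fg.
apply: fin_bigcap_measurable => // i _.
rewrite -[X in measurable X]setTI.
have : measurable_fun setT (fun t => f t ord0 i == g t ord0 i).
  by apply: measurable_fun_eqr; exact: (measurableT_comp (measurable_coord i)).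
by move=> /(_ measurableT [set true]); exact.
Qed.

Definition graph (f : E -> E) : set TE := [set p | p.2 = f p.1].

Lemma measurable_graph (f : E -> E) :
  measurable_fun setT f -> measurable (graph f).
Proof.
by move=> mf; apply: measurable_eqV => //; exact: measurableT_comp.
Qed.

(** The fiber operations use a chosen disintegration, of which only the measure that it rebuilds is
    known. That measure does not charge the complement of the graph, so for almost every [x] the
    nonnegative mass that [nu x] gives to the points other than [f x] is zero. *)
Lemma disintegration_kdirac mu (f : E -> E) (mf : measurable_fun setT f)
    (nu := disintegration mu (tensor mu (kdirac mf))) :
  {ae mu, forall x, {ae nu x, forall v, v = f x}}.
Proof.
have nuE : tensor mu (kdirac mf) ≡μ tensor mu nu.
  (* The default kernel is excluded because [kdirac mf] is itself a disintegration. *)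
  rewrite /nu /disintegration /pick_kernel; case: pselect => [h|[]].
    exact: (projT2 (cid h)).
  by exists (kdirac mf).
have mG := measurableC (measurable_graph mf).
have mk := measurable_kpush (@measurable_id _ TE setT) nu mG.
have : tensor mu nu (~` graph f) = 0.
  apply: etrans (esym (nuE _ mG)) _.
  apply: etrans (tensor_kdirac _ _ mG) _; apply: integral0_eq => x _.
  by rewrite indicE memNset//= => /(_ erefl).
rewrite /tensor.
rewrite (eq_integral (fun x => `| \int[nu x]_v (\1_(~` graph f) (x, v))%:E|));
  last by move=> x _; rewrite gee0_abs// integral_ge0// => v _; rewrite lee_fin.
move/(ae_eq_integral_abs mu measurableT mk).1.
apply: filterS => x /(_ Logic.I).
have mGx : measurable [set v | v <> f x].
  apply: measurableC; apply: measurable_eqV => //; exact: measurable_cst.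
have -> : (fun v => (\1_(~` graph f) (x, v))%:E : \bar R) =
    (fun v => (\1_[set v | v <> f x] v)%:E).
  by apply/funext => v; rewrite !indicE; congr ((nat_of_bool _)%:R%:E);
    rewrite /in_mem/= /in_set.
rewrite integral_indic// setIT => nu0.
by exists [set v | v <> f x]; split.
Qed.

Lemma ae_integral_cst d (T : measurableType d) 
    (m : {measure set T -> \bar R}) (h : T -> \bar R) c :
  m setT = 1 -> measurable_fun setT h -> (forall t, 0 <= h t) ->
  {ae m, forall t, h t = c} -> \int[m]_t h t = c.
Proof.
move=> m1 mh h0 hc.
(* An almost sure equality under a nonzero measure holds at some point. *)
have c0 : 0 <= c.
  have m0 : 0 < m setT by rewrite m1.
  by have [t <-] := @filter_ex _ _ (ae_properfilter_algebraOfSetsType m0) _ hc.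
rewrite (@ge0_ae_eq_integral _ _ _ _ _ _ (cst c))//.
  rewrite integral_cst//; apply: etrans (congr1 (mule c) m1) _.
  exact: mule1.
by apply: filterS hc.
Qed.

(** Evaluated at the Dirac mass at [x] and on the graph of [w], the two measures give the indicator
    of [v x = w x] and the value 1. *)
Lemma dirac_pvf_inj (v w : vec R n) : pvf_eq (dirac_pvf v) (dirac_pvf w) -> v = w.
Proof.
move=> vw; apply/val_inj/funext => x /=.
have mG := measurable_graph (measurable_vec w).
have := vw (dirac x) _ mG.
rewrite [LHS](tensor_kdirac (dirac x) (measurable_vec v) mG).
rewrite [RHS](tensor_kdirac (dirac x) (measurable_vec w) mG).
rewrite !integral_dirac// ?diracT ?mul1e; try by
  apply: (measurable_indic_pair mG); apply: measurable_graph_map;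
  exact: measurable_vec.
rewrite !indicE [X in _ = (nat_of_bool X)%:R%:E]mem_set//.
by have [/set_mem//|_ [/eqP]] := boolP (_ \in _); rewrite eq_sym oner_eq0.
Qed.

Lemma dirac_pvf0 : pvf_eq (dirac_pvf (0 : vec R n)%R) zero_pvf.
Proof.
move=> mu B mB.
rewrite [LHS](tensor_kdirac mu (measurable_vec (0 : vec R n)%R) mB).
by rewrite [RHS](tensor_kdirac mu (measurable_cst (0 : E)%R) mB).
Qed.

(** For almost every base point the chosen fiber measure is concentrated at [v x], so the inner
    integrand is almost surely constant. *)
Lemma dirac_pvfZ (a : R) (v : vec R n) :
  pvf_eq (dirac_pvf (a *: v)%R) (fiber_scale a (dirac_pvf v)).
Proof.
move=> mu B mB.
rewrite [LHS](tensor_kdirac mu (measurable_vec (a *: v)%R) mB).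
pose nu := disintegration mu (tensor mu (kdirac (measurable_vec v))).
rewrite -[RHS]/(fiber_scale_measure a mu nu B) /fiber_scale_measure.
have ms : measurable_fun setT (fun p : TE => (p.1, (a *: p.2)%R)).
  apply: measurable_fun_pair => //.
  exact: measurableT_comp (measurable_scalerV a) measurable_snd.
apply: ge0_ae_eq_integral => //.
- apply: (measurable_indic_pair mB); apply: measurable_graph_map.
  exact: measurable_vec.
- exact: (measurable_kpush ms).
- by move=> x _; apply: integral_ge0 => y _; rewrite lee_fin.
apply: filterS (disintegration_kdirac mu (measurable_vec v)) => x vx _.
apply/esym/ae_integral_cst => //; first exact: prob_kernel.
  apply: (measurable_indic_pair mB).
  exact: (measurableT_comp ms (pair1_measurable x)).
by apply: filterS vx => y ->.
Qed.

Lemma dirac_pvfD (v w : vec R n) :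
  pvf_eq (dirac_pvf (v + w)%R) (fiber_add (dirac_pvf v) (dirac_pvf w)).
Proof.
move=> mu B mB.
rewrite [LHS](tensor_kdirac mu (measurable_vec (v + w)%R) mB).
pose nu1 := disintegration mu (tensor mu (kdirac (measurable_vec v))).
pose nu2 := disintegration mu (tensor mu (kdirac (measurable_vec w))).
rewrite -[RHS]/(fiber_add_measure mu nu1 nu2 B) /fiber_add_measure.
have ms : measurable_fun setT (fun q : TE * E => (q.1.1, (q.1.2 + q.2)%R)).
  apply: measurable_fun_pair; first exact: measurableT_comp.
  apply: (measurableT_comp (@measurable_addrV R n)
    (_ : measurable_fun setT (fun q : TE * E => (q.1.2, q.2)))).
  by apply: measurable_fun_pair => //; exact: measurableT_comp.
(* [kernel_fst nu2] makes [nu2] a kernel on pairs (x, v), so that measurability of the innermost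
   integral in both variables is a case of [measurable_kpush]. *)
have mi := measurable_kpush ms (kernel_fst nu2) mB.
apply: ge0_ae_eq_integral => //.
- apply: (measurable_indic_pair mB); apply: measurable_graph_map.
  exact: measurable_vec.
- apply: (measurable_fun_integral_finite_kernel (fun p : TE =>
    \int[nu2 p.1]_u (\1_B (p.1, (p.2 + u)%R))%:E) nu1).
    by move=> p; apply: integral_ge0 => y _; rewrite lee_fin.
  exact: mi.
- move=> x _; apply: integral_ge0 => y _.
  by apply: integral_ge0 => z _; rewrite lee_fin.
have := disintegration_kdirac mu (measurable_vec w).
apply: filterS2 (disintegration_kdirac mu (measurable_vec v)) => x vx wx _.
apply/esym/ae_integral_cst => //; first exact: prob_kernel.
- exact: (measurableT_comp mi (pair1_measurable x)).
- by move=> y; apply: integral_ge0 => z _; rewrite lee_fin.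
apply: filterS vx => y ->; apply: ae_integral_cst => //.
  exact: prob_kernel.
  apply: (measurable_indic_pair mB).
  exact: (measurableT_comp ms (pair1_measurable (x, v x))).
by apply: filterS wx => z ->.
Qed.

End deterministic_fibers.

(** * Random bits with prescribed cylinder masses *)

Lemma probability_setI_full d (T : measurableType d) (R : realType)
    (P : probability T R) (A I : set T) :
  measurable A -> measurable I -> P I = 1%E -> P A = P (A `&` I).
Proof.
move=> mA mI PI; rewrite (measureDI P mA mI).
rewrite [X in (X + _)%E](_ : _ = 0%E) ?add0e//.
apply: (@subset_measure0 _ _ _ P _ (~` I)) => //.
- exact: measurableD.
- exact: measurableC.
- by have := probability_setC P mI; rewrite PI subee.
Qed.

Section ultrafilter_limits.
Context (R : realType) (I : Type) (U : set_system I) (UU : UltraFilter U).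

(** Compactness of the segment gives a cluster point, and an ultrafilter converges to its cluster
    points because it contains each set or its complement. *)
Lemma ultra_bounded_cvg (f : I -> R) (a b : R) :
  (forall i, a <= f i <= b) -> exists l : R, f i @[i --> U] --> l.
Proof.
move=> fab.
have [l [_ cl]] : (`[a, b] `&` cluster (f @ U)) !=set0.
  apply: (@segment_compact R a b (f @ U) _).
  by rewrite nbhs_filterE/=; apply: filterE => i /=; rewrite in_itv/= fab.
exists l => A Al; have [//|nA] := in_ultra_setVsetC (f @^-1` A) UU.
by have [x []] := cl (~` A) A nA Al.
Qed.

End ultrafilter_limits.

(* The first [m] bits of [a], the most recent one first. *)
Fixpoint code (A : Type) (b : nat -> A -> bool) (m : nat) (a : A) : seq bool :=
  if m is k.+1 then b k a :: code b k a else [::].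

Section code.
Local Open Scope ereal_scope.
Context d (A : measurableType d) (R : realType).
Implicit Types (b : nat -> A -> bool) (m : nat).

Lemma size_code (T : Type) (b : nat -> T -> bool) m a : size (code b m a) = m.
Proof. by elim: m => //= m ->. Qed.

Lemma nth_code (T : Type) (b : nat -> T -> bool) m a i : (i < m)%N ->
  nth false (rev (code b m a)) i = b i a.
Proof.
move=> im; rewrite nth_rev size_code//.
elim: m i im => // m ih i; rewrite ltnS leq_eqVlt => /predU1P[->|im].
  by rewrite subnn.
by rewrite subSS -(ih _ im) -(subnSK im).
Qed.

(** Only the bits below [m] are assumed measurable: [measurable_bit] applies this inside a strong
    induction, where the later bits are not yet known to be measurable. *)
Lemma measurable_code b m (h : seq bool -> R) :
  (forall i, (i < m)%N -> measurable_fun setT (b i)) ->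
  measurable_fun setT (fun a => h (code b m a)).
Proof.
elim: m h => [|m ih] h mb; first exact: (measurable_cst (h [::])).
rewrite (_ : (fun a => _) = fun a =>
    if b m a then h (true :: code b m a) else h (false :: code b m a)).
  apply: measurable_fun_ifT; first exact: mb.
  - by apply: (ih (fun s => h (true :: s))) => i im; apply: mb; exact: ltnW.
  - by apply: (ih (fun s => h (false :: s))) => i im; apply: mb; exact: ltnW.
by apply/funext => a /=; case: (b m a).
Qed.

Lemma measurable_code_eq b m s : (forall i, measurable_fun setT (b i)) ->
  measurable [set a | code b m a = s].
Proof.
move=> mb; have := @measurable_code b m (fun t => (t == s)%:R) (fun i _ => mb i).
move=> /(_ measurableT [set 1%R] (measurable_set1 _)); rewrite setTI.
congr measurable; apply/seteqP; split=> a /=.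
  by case: eqP => // _ /eqP; rewrite eq_sym oner_eq0.
by move=> ->; rewrite eqxx.
Qed.

(** A function of finitely many bits has finitely many values, so convergence of the cylinder masses
    will be enough for convergence of its integral. *)
Lemma integral_code (P : {measure set A -> \bar R}) b m (h : seq bool -> R) :
  (forall i, measurable_fun setT (b i)) -> (forall s, 0 <= h s)%R ->
  \int[P]_a (h (code b m a))%:E =
  \sum_(s : m.-tuple bool) (h s)%:E * P [set a | code b m a = s].
Proof.
move=> mb h0.
have mI (s : m.-tuple bool) :
    measurable_fun setT (fun a => (\1_[set a | code b m a = s] a)%:E : \bar R).
  by apply/measurable_EFinP; apply: measurable_indic; exact: measurable_code_eq.
transitivity (\int[P]_a \sum_(s : m.-tuple bool)
    (h s)%:E * (\1_[set a | code b m a = s] a)%:E).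
  apply: eq_integral => a _.
  have sz : size (code b m a) == m by rewrite size_code.
  rewrite (bigD1 (Tuple sz))//= big1 => [|s /eqP sa].
    by rewrite indicE mem_set// mule1 adde0.
  rewrite indicE memNset ?mule0//= => cs; apply: sa.
  by apply: val_inj; rewrite /= cs.
rewrite ge0_integral_sum//.
- apply: eq_bigr => s _; rewrite ge0_integralZl_EFin//.
  by rewrite integral_indic ?setIT//; exact: measurable_code_eq.
- by move=> s; apply: measurable_funeM.
- by move=> s a _; rewrite mule_ge0 ?lee_fin.
Qed.

End code.

(** * Nested intervals of prescribed lengths *)

Section bits_of_masses.
Context (R : realType) (p : seq bool -> R).
Hypothesis p_ge0 : forall s, 0 <= p s.
Hypothesis p_nil : p [::] = 1.
Hypothesis p_split : forall s, p s = p (true :: s) + p (false :: s).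

(* [lft s, lft s + p s[ is the interval of length [p s] attached to the
   word [s]; the one of [false :: s] is on the left of that of [true :: s]. *)
Fixpoint lft (s : seq bool) : R :=
  if s is x :: t then lft t + (if x then p (false :: t) else 0) else 0.

Fixpoint locate (m : nat) (w : R) : seq bool :=
  if m is k.+1 then
    let s := locate k w in (lft s + p (false :: s) <= w) :: s
  else [::].

Definition bit (k : nat) (w : R) : bool := head false (locate k.+1 w).

Lemma code_bit m w : code bit m w = locate m w.
Proof. by elim: m => //= m ->. Qed.

Lemma lft_bounds s : 0 <= lft s /\ lft s + p s <= 1.
Proof.
elim: s => [|x s [ih1 ih2]] /=; first by rewrite p_nil add0r.
have := p_split s; have := p_ge0 (true :: s); have := p_ge0 (false :: s).
by case: x => /=; lra.
Qed.

(** By [p_split] the intervals of [false :: s] and [true :: s] partition that of [s], so the descent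
    ends in the only interval of its level that contains [w]. *)
Lemma locateE m (s : seq bool) w : size s = m -> 0 <= w < 1 ->
  (locate m w == s) = (lft s <= w < lft s + p s).
Proof.
move=> sm w01; elim: s m sm => [|x s ih] m <-.
  by rewrite /= p_nil add0r w01.
have := p_split s; have := p_ge0 (true :: s); have := p_ge0 (false :: s).
rewrite [locate _ _]/= eqseq_cons => pf pt ps.
(* If the prefix found is not [s], then [w] is outside the interval of [s], hence outside both of
   its subintervals. *)
have [/eqP ls|/negbTE ls] := boolP (locate (size s) w == s); last first.
  rewrite andbF; move: ls; rewrite (ih _ erefl) => /negbT ls.
  apply/esym/negbTE; apply: contra ls => /=.
  by case: x; lra.
have := ih _ erefl; rewrite ls eqxx andbT => /esym/andP[lw wl].
case: x => /=; last by rewrite addr0 lw eqbF_neg -ltNge.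
have -> : w < lft s + p (false :: s) + p (true :: s) by lra.
by rewrite andbT eqb_id.
Qed.

(** Each bit compares [w] with a threshold that depends on all the earlier bits. *)
Lemma measurable_bit k : measurable_fun setT (bit k : R -> bool).
Proof.
elim/ltn_ind: k => k ih.
have -> : bit k = fun w => lft (code bit k w) + p (false :: code bit k w) <= w.
  by apply/funext => w; rewrite code_bit.
apply: measurable_fun_ler; last exact: measurable_id.
exact: (measurable_code (fun s => lft s + p (false :: s)) ih).
Qed.

Lemma uniform_prob_itv (l r : R) : 0 <= l -> l <= r -> r <= 1 ->
  uniform_prob (@ltr01 R) `[l, r[%classic = (r - l)%:E.
Proof.
move=> l0 lr r1; rewrite /uniform_prob (eq_integral (cst 1%E)) => [|x].
  rewrite integral_cst//= mul1e lebesgue_measure_itv/= lte_fin.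
  case: ltP => // rl; have -> : l = r by apply/eqP; rewrite eq_le lr.
  by rewrite subrr.
rewrite inE/= in_itv/= => /andP[lx xr].
rewrite /uniform_pdf (le_trans l0 lx) (ltW (lt_le_trans xr r1))/=.
by rewrite subr0 invr1.
Qed.

Lemma uniform_prob_code m s : size s = m ->
  uniform_prob (@ltr01 R) [set w | code bit m w = s] = (p s)%:E.
Proof.
move=> sm; have [l0 l1] := lft_bounds s.
have -> : (p s)%:E = uniform_prob (@ltr01 R) `[lft s, lft s + p s[%classic.
  by rewrite uniform_prob_itv ?lerDl// [_ + p s]addrC addrK.
have mC : measurable [set w : R | code bit m w = s].
  exact: (measurable_code_eq R m s measurable_bit).
(* [locateE] is restricted to [0, 1[, which carries the whole uniform law, so both sets may be cut
   down to it. *)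
have PI (A : set R) : measurable A ->
    uniform_prob (@ltr01 R) A = uniform_prob (@ltr01 R) (A `&` `[0, 1[%classic).
  move=> mA; apply: (probability_setI_full (P := uniform_prob ltr01)) => //.
  by apply: etrans (uniform_prob_itv (lexx _) ler01 (lexx _)) _; rewrite subr0.
rewrite PI// [RHS]PI//; congr (uniform_prob _ _).
apply/seteqP; split=> w /= [+ w01]; move: (w01); rewrite !in_itv/= => w01'.
  by move=> cw; split=> //; rewrite -(locateE sm)// -code_bit cw.
by rewrite -(locateE sm)// -code_bit => /eqP.
Qed.

End bits_of_masses.

(** * Limits of cylinder masses along an ultrafilter *)

Section limit_law_of_bits.
Local Open Scope ereal_scope.
Context d (A : measurableType d) (R : realType).
Context (I : Type) (U : set_system I) (UU : UltraFilter U).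
Variables (P : I -> probability A R) (b : nat -> A -> bool).
Hypothesis mb : forall i, measurable_fun setT (b i).

Let cyl s := [set a | code b (size s) a = s].

Let mcyl s : measurable (cyl s).
Proof. exact: (measurable_code_eq R _ _ mb). Qed.

Let Pcyl_fin i s : P i (cyl s) \is a fin_num.
Proof. exact: fin_num_measure. Qed.

Let mass_cvg s : exists l : R, fine (P i (cyl s)) @[i --> U] --> l.
Proof.
apply: (@ultra_bounded_cvg R I U UU _ 0%R 1%R) => i.
by rewrite fine_ge0//= -lee_fin fineK//; exact: probability_le1.
Qed.

Let p s : R := projT1 (cid (mass_cvg s)).

Let p_cvg s : fine (P i (cyl s)) @[i --> U] --> p s.
Proof. by rewrite /p; case: cid. Qed.

Let UP : ProperFilter U. Proof. exact: ultra_proper. Qed.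

Let p_ge0 s : (0 <= p s)%R.
Proof.
rewrite -(cvg_lim (@Rhausdorff R) (@p_cvg s)).
apply: limr_ge; first by apply/cvg_ex; exists (p s); exact: @p_cvg.
by apply: filterE => i; exact: fine_ge0.
Qed.

Let p_nil : p [::] = 1%R.
Proof.
apply: (cvg_unique (@Rhausdorff R) (@p_cvg [::])).
rewrite (_ : (fun i => _) = cst 1%R); first exact: cvg_cst.
apply/funext => i /=; rewrite (_ : cyl _ = setT) ?probability_setT//.
by apply/seteqP; split.
Qed.

Let p_split s : p s = (p (true :: s) + p (false :: s))%R.
Proof.
apply: (cvg_unique (@Rhausdorff R) (@p_cvg s)).
have -> : (fun i => fine (P i (cyl s))) =
    ((fun i => fine (P i (cyl (true :: s)))) \+
     (fun i => fine (P i (cyl (false :: s)))))%R; last first.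
  by apply: cvgD; exact: p_cvg.
apply/funext => i /=; rewrite -fineD// -measureU//.
  congr (fine (P i _)); apply/seteqP; split=> a; rewrite /cyl/=.
    by move=> sa; case: (b _ a); [left|right]; rewrite sa.
  by case=> -[_ ->].
by apply/seteqP; split=> // a []; rewrite /cyl/= => -[-> _] [].
Qed.

(** The limit space is the real line with the uniform law on [0, 1] and the bits built from [p].
    Both integrals expand into finite sums over words, which converge term by term. *)
Lemma limit_law_of_bits : exists d' (W : measurableType d')
    (Q : probability W R) (xi : nat -> W -> bool),
  (forall k, measurable_fun setT (xi k)) /\
  forall m (h : seq bool -> R), (forall s, 0 <= h s)%R ->
    \int[P i]_a (h (code b m a))%:E @[i --> U] -->
    \int[Q]_w (h (code xi m w))%:E.
Proof.
exists _, _, (uniform_prob (@ltr01 R)), (bit p).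
split=> [k|m h h0]; first exact: measurable_bit.
rewrite integral_code//; last exact: measurable_bit.
under eq_fun do rewrite (integral_code _ _ mb h0).
apply: cvg_nnesum => s _.
  by apply: filterE => i; rewrite mule_ge0 ?lee_fin.
apply: cvgeZl => //.
have : P i (cyl s) @[i --> U] --> (p s)%:E.
  by apply: cvg_EFin; [exact: filterE|exact: p_cvg].
rewrite -(uniform_prob_code p_ge0 p_nil p_split (size_tuple s)).
by rewrite /cyl size_tuple; exact.
Qed.

End limit_law_of_bits.

(** * Weak compactness on a cube *)

Section signed_dyadic_digits.
Context (R : realType) (r : R).
Hypothesis r_ge0 : 0 <= r.

Definition digit (x : bool) (i : nat) : R := (if x then r else - r) / 2 ^+ i.+1.

Definition dyadic (b : nat -> bool) : R ^nat := series (fun i => digit (b i) i).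

(** Greedy expansion: each signed digit moves the partial sum towards [t]. *)
Fixpoint approx (t : R) (N : nat) : R :=
  if N is k.+1 then approx t k + digit (approx t k <= t) k else 0.

Definition dbit (t : R) (k : nat) : bool := approx t k <= t.

Lemma dyadicS b N : dyadic b N.+1 = dyadic b N + digit (b N) N.
Proof. by rewrite /dyadic /series/= big_nat_recr. Qed.

Lemma dyadic0 b : dyadic b 0 = 0.
Proof. by rewrite /dyadic /series/= big_geq. Qed.

Lemma dyadic_dbit t : dyadic (dbit t) = approx t.
Proof.
apply/funext; elim=> [|N ih]; first by rewrite dyadic0.
by rewrite dyadicS ih.
Qed.

Lemma halfS N : r / 2 ^+ N = r / 2 ^+ N.+1 + r / 2 ^+ N.+1.
Proof. by rewrite exprS invfM; field; rewrite expf_neq0. Qed.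

(** A step of length [r / 2 ^+ N.+1] towards [t], from a distance of at most twice that length, ends
    within that length of [t] even when it overshoots. *)
Lemma approx_err t N : `|t| <= r -> `|t - approx t N| <= r / 2 ^+ N.
Proof.
move=> tr; elim: N => [|N ih]; first by rewrite subr0 expr0 divr1.
move: ih; rewrite (halfS N) /= /digit.
have : 0 <= r / 2 ^+ N.+1 by rewrite divr_ge0// exprn_ge0.
rewrite !ler_norml; case: (leP (approx t N) t) => ? /=; first lra.
by rewrite mulNr; lra.
Qed.

Lemma normr_digit x i : `|digit x i| = r / 2 ^+ i.+1.
Proof.
rewrite /digit normrM normfV normrX (ger0_norm (ler0n R 2)).
by case: x; rewrite ?normrN ger0_norm.
Qed.

(** The exact geometric tail is kept on the right-hand side so that the induction on [M] goes
    through. *)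
Lemma dyadic_close b N M : (N <= M)%N ->
  `|dyadic b M - dyadic b N| <= r / 2 ^+ N - r / 2 ^+ M.
Proof.
move=> /subnK <-; elim: (M - N)%N => [|k ih]; first by rewrite !subrr normr0.
rewrite addSn dyadicS addrAC (le_trans (ler_normD _ _))//.
by rewrite normr_digit; move: ih; rewrite (halfS (k + N)); lra.
Qed.

Lemma dyadic_cvg b : cvgn (dyadic b).
Proof.
apply: normed_cvg; apply: (@series_le_cvg _ _ (geometric (r / 2) 2^-1)).
- by move=> n; exact: normr_ge0.
- by move=> n; rewrite /geometric/= mulr_ge0 ?divr_ge0// exprn_ge0.
- by move=> n; rewrite /= normr_digit /geometric/= exprS invfM exprVn mulrA.
apply: is_cvg_geometric_series; rewrite ger0_norm// invf_lt1//.
by rewrite ltr1n.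
Qed.

(** The bits are arbitrary here because those of the limit law need not be the greedy expansion of
    the point that they code. *)
Lemma lim_dyadic_err b N : `|limn (dyadic b) - dyadic b N| <= r / 2 ^+ N.
Proof.
have close M : (N <= M)%N -> `|dyadic b M - dyadic b N| <= r / 2 ^+ N.
  move=> NM; rewrite (le_trans (dyadic_close b NM))// gerBl.
  by rewrite divr_ge0// exprn_ge0.
rewrite ler_distl; apply/andP; split.
- apply: limr_ge; first exact: dyadic_cvg.
  near=> M; have := close M; rewrite ler_distl => /(_ _)/andP[]//.
  by near: M; exists N.
- apply: limr_le; first exact: dyadic_cvg.
  near=> M; have := close M; rewrite ler_distl => /(_ _)/andP[]//.
  by near: M; exists N.
Unshelve. all: by end_near. Qed.

End signed_dyadic_digits.

Lemma measurable_approx d (A : measurableType d) (R : realType) (r : R)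
    (f : A -> R) N :
  measurable_fun setT f -> measurable_fun setT (fun a => approx r (f a) N).
Proof.
move=> mf; elim: N => [|N ih]; first exact: (measurable_cst (0 : R)).
apply: measurable_funD => //; rewrite /digit; apply: measurable_funM => //.
by apply: measurable_fun_ifT => //; exact: measurable_fun_ler.
Qed.

Lemma norm_rV_le (R : realType) (m : nat) (x : 'rV[R]_m) (e : R) :
  0 <= e -> (forall j, `|x ord0 j| <= e) -> `|x| <= e.
Proof.
move=> e0 xe; rewrite [leLHS]/Num.Def.normr/= mx_normrE.
by apply/bigmax_leP; split=> // -[i j] _ /=; rewrite (ord1 i).
Qed.

(** * Integrals of functions that are uniformly close *)

Section integral_comparison.
Local Open Scope ereal_scope.
Context d (T : measurableType d) (R : realType) (P : probability T R).

Lemma ae_full (A : set T) : measurable A -> P A = 1 -> {ae P, forall x, A x}.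
Proof.
move=> mA PA; exists (~` A); split=> //; first exact: measurableC.
by have := probability_setC P mA; rewrite PA subee.
Qed.

Lemma integral_le_close (f g : T -> R) (e : R) :
  measurable_fun setT f -> measurable_fun setT g ->
  (forall x, 0 <= f x)%R -> (forall x, 0 <= g x)%R -> (0 <= e)%R ->
  {ae P, forall x, `|f x - g x| <= e}%R ->
  \int[P]_x (f x)%:E <= \int[P]_x (g x)%:E + e%:E.
Proof.
move=> mf mg f0 g0 e0 fg.
have eE : e%:E = \int[P]__ e%:E.
  by rewrite integral_prob_cst//; exact: probability_setT.
rewrite [in leRHS]eE -ge0_integralD//; last 2 first.
- by move=> x _; rewrite lee_fin.
- exact/measurable_EFinP.
apply: ae_ge0_le_integral => //.
- by move=> x _; rewrite lee_fin.
- exact/measurable_EFinP.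
- by move=> x _; rewrite adde_ge0 ?lee_fin.
- by apply: emeasurable_funD => //; exact/measurable_EFinP.
apply: filterS fg => x fgx _; rewrite -EFinD lee_fin.
by move: fgx; rewrite ler_distl => /andP[].
Qed.

(** Finiteness is transferred from one integral to the other, which gives meaning to [fine] in the
    estimate. *)
Lemma integral_close (f g : T -> R) (e : R) :
  measurable_fun setT f -> measurable_fun setT g ->
  (forall x, 0 <= f x)%R -> (forall x, 0 <= g x)%R -> (0 <= e)%R ->
  {ae P, forall x, `|f x - g x| <= e}%R ->
  \int[P]_x (g x)%:E \is a fin_num ->
  \int[P]_x (f x)%:E \is a fin_num /\
  (`|fine (\int[P]_x (f x)%:E) - fine (\int[P]_x (g x)%:E)| <= e)%R.
Proof.
move=> mf mg f0 g0 e0 fg gfin.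
have fg' : {ae P, forall x, `|g x - f x| <= e}%R.
  by apply: filterS fg => x; rewrite distrC.
have I0 (h : T -> R) : (forall x, 0 <= h x)%R -> 0 <= \int[P]_x (h x)%:E.
  by move=> h0; apply: integral_ge0 => x _; rewrite lee_fin.
have le1 := integral_le_close mf mg f0 g0 e0 fg.
have ffin : \int[P]_x (f x)%:E \is a fin_num.
  rewrite ge0_fin_numE ?I0// (le_lt_trans le1)// lte_add_pinfty ?ltry//.
  by rewrite -ge0_fin_numE ?I0.
have := integral_le_close mg mf g0 f0 e0 fg'; move: le1.
rewrite -(fineK ffin) -(fineK gfin) -!EFinD !lee_fin !fineK// => h1 h2.
by split=> //; rewrite ler_distl; lra.
Qed.

End integral_comparison.

Definition law d d' (T : measurableType d) (T' : measurableType d')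
    (R : realType) (P : probability T R) (f : T -> T')
    (mf : measurable_fun setT f) : probability T' R :=
  distribution P (mfun_Sub (mem_set mf)).

Lemma integral_law d d' (T : measurableType d) (T' : measurableType d')
    (R : realType) (P : probability T R) (f : T -> T')
    (mf : measurable_fun setT f) (g : T' -> \bar R) :
  measurable_fun setT g -> (forall y, 0 <= g y)%E ->
  (\int[law P mf]_y g y = \int[P]_x g (f x))%E.
Proof. by move=> mg g0; rewrite ge0_integral_distribution. Qed.

Section weak_compactness.
Local Open Scope ereal_scope.
Context (R : realType) (d : nat) (r : R).
Local Notation E := 'rV[R]_d.
Context (I : Type) (U : set_system I) (UU : UltraFilter U).
Variable P : I -> probability E R.
Hypothesis r_ge0 : (0 <= r)%R.
Hypothesis P_cube : forall i, {ae P i, forall x : E, forall j, `|x ord0 j| <= r}%R.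

(** The digits of all coordinates are interleaved in one sequence, indexed by the codes of pairs
    (coordinate, position); an index that codes no pair gets the bit [false]. *)
Let b (k : nat) (x : E) : bool :=
  if (unpickle k : option ('I_d * nat)) is Some (j, i) then
    dbit r (x ord0 j) i else false.

Let mb k : measurable_fun setT (b k).
Proof.
rewrite /b; case: (unpickle k : option ('I_d * nat)) => [[j i]|].
  apply: measurable_fun_ler; first exact: measurable_approx (measurable_coord j).
  exact: measurable_coord.
exact: measurable_cst.
Qed.

Let dec N (c : nat -> bool) : E :=
  (\row_j dyadic r (fun i => c (pickle (j, i))) N)%R.

(** Length of a prefix that contains the first [N] digits of every coordinate; the successor turns
    the largest index into a length. *)
Let bound N : nat :=
  \max_(j < d) \max_(i < N) (pickle (j, nat_of_ord i)).+1.

Let pickle_bound N (j : 'I_d) (i : nat) :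
  (i < N)%N -> (pickle (j, i) < bound N)%N.
Proof.
move=> iN; rewrite /bound (bigD1 j)//= leq_max; apply/orP; left.
by rewrite (bigD1 (Ordinal iN))//= leq_max leqnn.
Qed.

(** The truncated point is a function of a finite code, as [limit_law_of_bits] requires; [rev]
    undoes the order with the most recent bit first. *)
Let dec_code (A : Type) (c : nat -> A -> bool) N a :
  dec N (nth false (rev (code c (bound N) a))) = dec N (c ^~ a).
Proof.
apply/rowP => j; rewrite !mxE /dyadic /series/=.
apply: eq_big_nat => i /andP[_ iN]; congr (digit _ _ _).
by rewrite nth_code// pickle_bound.
Qed.

Let err_ge0 N : (0 <= r / 2 ^+ N)%R.
Proof. by rewrite divr_ge0// exprn_ge0. Qed.

Let dec_err (x : E) N : (forall j, `|x ord0 j| <= r)%R ->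
  (`|x - dec N (b ^~ x)| <= r / 2 ^+ N)%R.
Proof.
move=> xr; apply: norm_rV_le => // j; rewrite !mxE.
rewrite (_ : (fun i => _) = dbit r (x ord0 j)); last first.
  by apply/funext => i; rewrite /b pickleK.
by rewrite dyadic_dbit approx_err.
Qed.

(** Truncating to [N] digits changes a Lipschitz function by at most [L * (r / 2 ^+ N)], uniformly
    in [i] and also for the limit. For fixed [N] only finitely many bits matter, and their laws
    converge. *)
Theorem weak_compactness : exists Q : probability E R,
  forall (f : E -> R) (L : R), measurable_fun setT f ->
    (forall x, 0 <= f x)%R -> (0 <= L)%R ->
    (forall x y, `|f x - f y| <= L * `|x - y|)%R ->
    \int[P i]_x (f x)%:E @[i --> U] --> \int[Q]_x (f x)%:E.
Proof.
have UP : ProperFilter U by exact: ultra_proper.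
have [d' [W [lam [xi [mxi cvg_xi]]]]] := limit_law_of_bits UU P mb.
pose S N w := dec N (xi ^~ w).
(* The point coded by the random bits; its law is the limit measure. *)
pose X w : E := (\row_j limn (dyadic r (fun i => xi (pickle (j, i)) w)))%R.
have mdy j N : measurable_fun setT
    (fun w => dyadic r (fun i => xi (pickle (j, i)) w) N).
  elim: N => [|N ih].
    by under eq_fun do rewrite dyadic0; exact: measurable_cst.
  under eq_fun do rewrite dyadicS; apply: measurable_funD => //.
  rewrite /digit; apply: measurable_funM => //.
  by apply: measurable_fun_ifT => //; exact: measurable_cst.
have mX : measurable_fun setT X.
  apply: measurable_fun_rV => j; under eq_fun do rewrite mxE.
  apply: (@measurable_fun_cvg _ _ _ _
    (fun N w => dyadic r (fun i => xi (pickle (j, i)) w) N)) => // w _.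
  exact: dyadic_cvg.
have mS N : measurable_fun setT (S N).
  by apply: measurable_fun_rV => j; under eq_fun do rewrite mxE; exact: mdy.
have X_err w N : (`|X w - S N w| <= r / 2 ^+ N)%R.
  by apply: norm_rV_le => // j; rewrite !mxE lim_dyadic_err.
exists (law lam mX) => f L mf f0 L0 fL.
rewrite integral_law//; last exact/measurable_EFinP.
have mdec N : measurable_fun setT (fun x => f (dec N (b ^~ x))).
  under eq_fun do rewrite -dec_code.
  exact: (@measurable_code _ _ _ b (bound N) (fun s => f (dec N (nth false (rev s))))
    (fun i _ => mb i)).
have cvgN N : \int[P i]_x (f (dec N (b ^~ x)))%:E @[i --> U] -->
    \int[lam]_w (f (S N w))%:E.
  have := cvg_xi (bound N) (fun s => f (dec N (nth false (rev s)))) (fun _ => f0 _).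
  under eq_fun do under eq_integral do rewrite dec_code.
  by under eq_integral do rewrite dec_code.
have e0 N : (0 <= L * (r / 2 ^+ N))%R by rewrite mulr_ge0.
have cst_fin d1 (T : measurableType d1) (m : probability T R) :
    \int[m]__ (f 0)%:E \is a fin_num.
  by rewrite integral_prob_cst//; exact: probability_setT.
(* On the cube [f] differs from the constant [f 0] by at most [L * r]. *)
have ffin i : \int[P i]_x (f x)%:E \is a fin_num.
  have ae0 : {ae P i, forall x, `|f x - cst (f 0) x| <= L * r}%R.
    apply: filterS (P_cube i) => x xr; rewrite (le_trans (fL _ _))// subr0.
    by rewrite ler_wpM2l// norm_rV_le.
  exact: (integral_close mf (measurable_cst (f 0%R)) f0 (fun _ => f0 _)
    (mulr_ge0 L0 r_ge0) ae0 (cst_fin _ _ _)).1.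
have fclose N i : \int[P i]_x (f (dec N (b ^~ x)))%:E \is a fin_num /\
    (`|fine (\int[P i]_x (f (dec N (b ^~ x)))%:E) -
      fine (\int[P i]_x (f x)%:E)| <= L * (r / 2 ^+ N))%R.
  have ae0 : {ae P i, forall x,
      `|f (dec N (b ^~ x)) - f x| <= L * (r / 2 ^+ N)}%R.
    apply: filterS (P_cube i) => x xr; rewrite (le_trans (fL _ _))//.
    by rewrite ler_wpM2l// distrC dec_err.
  exact: (integral_close (mdec N) mf (fun _ => f0 _) f0 (e0 N) ae0 (ffin i)).
have mfX : measurable_fun setT (fun w => f (X w)) by exact: measurableT_comp.
have mfS N : measurable_fun setT (fun w => f (S N w)) by exact: measurableT_comp.
(* [S 0] reads no digit, so it is constantly the origin. *)
have Sfin : \int[lam]_w (f (S 0%N w))%:E \is a fin_num.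
  rewrite (_ : (fun w => _) = fun=> (f 0%R)%:E); first exact: cst_fin.
  apply/funext => w; congr (f _)%:E; apply/rowP => j.
  by rewrite !mxE dyadic0.
have Xae N : {ae lam, forall w, `|f (X w) - f (S N w)| <= L * (r / 2 ^+ N)}%R.
  by apply: aeW => w; rewrite (le_trans (fL _ _))// ler_wpM2l.
have Xfin : \int[lam]_w (f (X w))%:E \is a fin_num.
  exact: (integral_close mfX (mfS 0%N) (fun _ => f0 _) (fun _ => f0 _)
    (e0 0%N) (Xae 0%N) Sfin).1.
have Xclose N : \int[lam]_w (f (S N w))%:E \is a fin_num /\
    (`|fine (\int[lam]_w (f (S N w))%:E) - fine (\int[lam]_w (f (X w))%:E)|
      <= L * (r / 2 ^+ N))%R.
  apply: (integral_close (mfS N) mfX (fun _ => f0 _) (fun _ => f0 _)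
    (e0 N) _ Xfin).
  by apply: filterS (Xae N) => w; rewrite distrC.
rewrite -(fineK Xfin); apply: cvg_EFin; first exact: filterE.
apply/cvgrPdist_le => e e_gt0 /=.
(* One third of [e] each for the truncation under [P i], the truncation under [lam], and the
   convergence at fixed [N]; this [N] serves all [i]. *)
have [N Ne] : exists N, (L * (r / 2 ^+ N) <= e / 3)%R.
  have half1 : (`|2^-1 : R| < 1)%R by rewrite ger0_norm// invf_lt1// ltr1n.
  have /cvgrPdist_le/(_ (e / 3)%R) := cvg_geometric (L * r)%R half1.
  rewrite divr_gt0// => /(_ erefl)[N _ /(_ N (leqnn N))] /=.
  rewrite sub0r normrN /geometric/= exprVn => /(le_trans (ler_norm _)).
  by exists N; rewrite mulrA.
have [Xf Xc] := Xclose N.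
have := cvgN N; rewrite -(fineK Xf) => /fine_cvg/cvgrPdist_le/(_ (e / 3)%R).
rewrite divr_gt0// => /(_ erefl); apply: filterS => i /=.
have [Pf Pc] := fclose N i.
move: Xc Pc; rewrite !ler_distl => /andP[? ?] /andP[? ?] /andP[? ?].
by apply/andP; split; lra.
Qed.

End weak_compactness.

(** * Lipschitz functions determine a measure *)

Section lipschitz_functions.
Context (R : realType) (n : nat).
Local Notation E := 'rV[R]_n.
Implicit Types x y z : E.

Lemma norm_le_enorm x : `|x| <= enorm x.
Proof.
by apply: norm_rV_le => [|j]; [exact: enorm_ge0|exact: ler_coord_enorm].
Qed.

Lemma enormN x : enorm (- x) = enorm x.
Proof. by rewrite -scaleN1r enormZ normrN1 mul1r. Qed.

Lemma enorm_lipschitz x y : `|enorm x - enorm y| <= Num.sqrt n%:R * `|x - y|.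
Proof.
rewrite (le_trans _ (ler_enorm_norm _))// ler_distl.
have := ler_enormD (x - y) y; have := ler_enormD (y - x) x.
by rewrite !subrK -(enormN (y - x)) opprB => ? ?; apply/andP; split; lra.
Qed.

Lemma measurable_lipschitz (f : E -> R) (L : R) :
  (forall x y, `|f x - f y| <= L * `|x - y|) -> measurable_fun setT f.
Proof.
move=> fL; have cf : continuous f.
  move=> x B /nbhs_ballP[e /= e0 xB].
  have L1 : 0 < `|L| + 1 by rewrite ltr_wpDl.
  apply/nbhs_ballP; exists (e / (`|L| + 1)); first exact: divr_gt0.
  move=> y; rewrite -ball_normE/= ltr_pdivlMr// mulrC => xy; apply: xB.
  rewrite -ball_normE/=; apply: le_lt_trans xy.
  rewrite (le_trans (fL _ _))// ler_wpM2r// (le_trans (ler_norm _))//.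
  by rewrite lerDl.
apply: (measurability _ (RGenOInfty.measurableE R)).
move=> _ [_ [a ->] <-]; rewrite setTI; apply: measurable_open_rV.
by move/continuousP : cf; apply; exact: rray_open.
Qed.

Lemma measurable_enorm : measurable_fun setT (@enorm R n).
Proof. exact: measurable_lipschitz enorm_lipschitz. Qed.

Section distance.
Variable A : set E.
Hypothesis A0 : A !=set0.

Definition dist_to x : R := inf [set `|x - y| | y in A].

Let dset_lb x : has_lbound [set `|x - y| | y in A].
Proof. by exists 0 => _ [y _ <-]. Qed.

Lemma dist_to_ge0 x : 0 <= dist_to x.
Proof.
apply: lb_le_inf; first by case: A0 => a Aa; exists `|x - a|, a.
by move=> _ [y _ <-].
Qed.

Lemma dist_to_triangle x z : dist_to x <= `|x - z| + dist_to z.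
Proof.
rewrite -lerBlDl; apply: lb_le_inf; first by case: A0 => a Aa; exists `|z - a|, a.
move=> _ [y Ay <-]; rewrite lerBlDl (@le_trans _ _ `|x - y|)//.
  by apply: ge_inf => //; exists y.
by rewrite -(subrKA z) ler_normD.
Qed.

Lemma dist_to_in x : A x -> dist_to x = 0.
Proof.
move=> Ax; apply/eqP; rewrite eq_le dist_to_ge0 andbT.
by apply: ge_inf => //; exists x => //; rewrite subrr normr0.
Qed.

Lemma dist_to_notin x : closed A -> ~ A x -> 0 < dist_to x.
Proof.
move=> cA nAx; have : nbhs x (~` A).
  by apply: open_nbhs_nbhs; split => //; exact: closed_openC.
move=> /nbhs_ballP[e /= e0 xA]; rewrite (lt_le_trans e0)//.
apply: lb_le_inf; first by case: A0 => a Aa; exists `|x - a|, a.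
move=> _ [y Ay <-]; rewrite leNgt; apply/negP => xy.
by apply: (xA y) => //; rewrite -ball_normE.
Qed.

(** Lipschitz approximations of the indicator of the complement of [A]: they vanish on [A] and, if
    [A] is closed, equal 1 at any other given point for large [k]. *)
Definition cutoff (k : nat) x : R := Num.min 1 (k%:R * dist_to x).

Lemma cutoff_ge0 k x : 0 <= cutoff k x.
Proof. by rewrite le_min ler01/= mulr_ge0// dist_to_ge0. Qed.

Lemma cutoff_lipschitz k x y : `|cutoff k x - cutoff k y| <= k%:R * `|x - y|.
Proof.
have tri := dist_to_triangle x y; have tri' := dist_to_triangle y x.
have k0 : 0 <= k%:R :> R by [].
have {tri} h1 : k%:R * dist_to x <= k%:R * `|x - y| + k%:R * dist_to y.
  by rewrite -mulrDr ler_wpM2l.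
have {tri'} h2 : k%:R * dist_to y <= k%:R * `|x - y| + k%:R * dist_to x.
  by rewrite -mulrDr ler_wpM2l// distrC.
have h3 : 0 <= k%:R * `|x - y| by rewrite mulr_ge0.
rewrite /cutoff; set a := _ * dist_to x in h1 h2 *.
set b := _ * dist_to y in h1 h2 *; set c := _ * _ in h1 h2 h3 *.
by rewrite ler_norml /Num.min; case: ifPn; case: ifPn; rewrite -?leNgt; lra.
Qed.

Lemma cutoff_cvg x : closed A -> cutoff k x @[k --> \oo] --> (\1_(~` A) x : R).
Proof.
move=> cA; rewrite indicE; have [Ax|nAx] := pselect (A x).
  rewrite memNset; last by move=> /(_ Ax).
  rewrite (_ : (fun k => _) = cst 0); first exact: cvg_cst.
  by apply/funext => k; rewrite /cutoff dist_to_in// mulr0 min_r.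
rewrite mem_set//; apply: cvg_near_cst; have d0 := dist_to_notin cA nAx.
near=> k; rewrite /cutoff min_l//.
rewrite -ler_pdivrMr// div1r; near: k; exact: nbhs_infty_ger.
Unshelve. all: by end_near. Qed.

End distance.

Local Open Scope ereal_scope.

(** The open sets are stable under intersection and generate the Borel sets, and by dominated
    convergence the mass of an open set is the limit of the integrals of the cutoffs of its
    complement. *)
Lemma lipschitz_integral_unique (m1 m2 : probability E R) :
  (forall (f : E -> R) (L : R), (forall x, 0 <= f x)%R -> (0 <= L)%R ->
    (forall x y, `|f x - f y| <= L * `|x - y|)%R ->
    \int[m1]_x (f x)%:E = \int[m2]_x (f x)%:E) ->
  m1 ≡μ m2.
Proof.
move=> m12 B mB; apply: (@measure_unique _ _ _ (open_mx R 1 n) (fun=> setT)) => //.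
- by move=> ? ? ? ?; exact: openI.
- by move=> _; exact: openT.
- by rewrite bigcup_const//; exists 0%N.
(* The whole space is treated apart because the distance function needs a nonempty complement. *)
- move=> V oV; have [VT|VnT] := pselect (~` V = set0).
    have -> : V = setT by rewrite -(setCK V) VT setC0.
    exact: etrans (probability_setT m1) (esym (probability_setT m2)).
  have A0 : ~` V !=set0 by apply/set0P/eqP.
  have cA := open_closedC oV.
  have cutoff_lim (m : probability E R) :
      \int[m]_x (cutoff (~` V) k x)%:E @[k --> \oo] --> m V.
    have mV : measurable V by exact: measurable_open_rV.
    have -> : m V = \int[m]_x (\1_V x)%:E by rewrite integral_indic// setIT.
    have [] // := @dominated_convergence _ _ _ m setT measurableT
      (fun k x => (cutoff (~` V) k x)%:E) (fun x => (\1_V x)%:E) (cst 1).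
    + move=> k; apply/measurable_EFinP.
      exact: measurable_lipschitz (cutoff_lipschitz A0 k).
    + by apply/measurable_EFinP; exact: measurable_indic.
    + apply: aeW => x _; apply: cvg_EFin; first exact: filterE.
      by have := cutoff_cvg A0 (x := x) cA; rewrite setCK.
    + exact: finite_measure_integrable_cst.
    + apply: aeW => x k _; rewrite gee0_abs ?lee_fin ?cutoff_ge0//.
      by rewrite ge_min lexx.
  apply: (cvg_unique _ (cutoff_lim m1)) => //.
  rewrite (_ : (fun k => _) = fun k => \int[m2]_x (cutoff (~` V) k x)%:E).
    exact: cutoff_lim.
  apply/funext => k; apply: (m12 _ k%:R) => //; first exact: cutoff_ge0.
  exact: cutoff_lipschitz.
- move=> _; apply: le_lt_trans (ltry 1%R).
  exact: (probability_le1 m1 measurableT).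
Qed.

End lipschitz_functions.

(** * Existence of optimal couplings *)

Section row_blocks.
Context (R : realType) (n : nat).
Local Notation E := 'rV[R]_n.
Implicit Types z : 'rV[R]_(n + n).

Lemma ler_coord_norm m (x : 'rV[R]_m) i : `|x ord0 i| <= `|x|.
Proof.
rewrite [leRHS]/Num.Def.normr/= mx_normrE.
by apply/bigmax_geP; right => /=; exists (ord0, i).
Qed.

Lemma norm_lsubmx z : `|lsubmx z| <= `|z|.
Proof.
by apply: norm_rV_le => // j; rewrite mxE ler_coord_norm.
Qed.

Lemma norm_rsubmx z : `|rsubmx z| <= `|z|.
Proof.
by apply: norm_rV_le => // j; rewrite mxE ler_coord_norm.
Qed.

Lemma measurable_lsubmx : measurable_fun setT (@lsubmx R 1 n n).
Proof.
by apply: measurable_fun_rV => i; under eq_fun do rewrite mxE;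
  exact: measurable_coord.
Qed.

Lemma measurable_rsubmx : measurable_fun setT (@rsubmx R 1 n n).
Proof.
by apply: measurable_fun_rV => i; under eq_fun do rewrite mxE;
  exact: measurable_coord.
Qed.

(** [weak_compactness] is about row vectors, so a pair of points is encoded as one row of length
    [n + n]. *)
Definition row_pair (p : E * E) : 'rV[R]_(n + n) := row_mx p.1 p.2.

Definition row_split z : E * E := (lsubmx z, rsubmx z).

Lemma measurable_row_split : measurable_fun setT row_split.
Proof.
exact: measurable_fun_pair measurable_lsubmx measurable_rsubmx.
Qed.

Lemma measurable_row_pair : measurable_fun setT row_pair.
Proof.
apply: measurable_fun_rV => i; rewrite /row_pair.
under eq_fun do rewrite mxE; case: (fintype.split i) => j.
  exact: (measurableT_comp (measurable_coord j) measurable_fst).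
exact: (measurableT_comp (measurable_coord j) measurable_snd).
Qed.

Lemma measurable_subV : measurable_fun setT (fun p : E * E => p.1 - p.2).
Proof.
apply: measurable_fun_rV => i; under eq_fun do rewrite !mxE.
by apply: measurable_funB; apply: measurableT_comp (measurable_coord i) _.
Qed.

Definition split_cost z : R := enorm (lsubmx z - rsubmx z).

Lemma split_cost_lipschitz z z' :
  `|split_cost z - split_cost z'| <= (Num.sqrt n%:R * 2) * `|z - z'|.
Proof.
rewrite (le_trans (enorm_lipschitz _ _))// -mulrA ler_wpM2l ?sqrtr_ge0//.
have -> : lsubmx z - rsubmx z - (lsubmx z' - rsubmx z') =
    lsubmx (z - z') - rsubmx (z - z') :> E.
  by apply/rowP => i; rewrite !mxE; ring.
rewrite (le_trans (ler_normB _ _))// mulr_natl mulr2n.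
by rewrite lerD ?norm_lsubmx ?norm_rsubmx.
Qed.

End row_blocks.

Section optimal_coupling.
Local Open Scope ereal_scope.
Context (R : realType) (n : nat) (r : R) (mu nu : probability 'rV[R]_n R).
Local Notation E := 'rV[R]_n.
Hypothesis r_ge0 : (0 <= r)%R.
Hypothesis mu_cube : {ae mu, forall x : E, forall j, `|x ord0 j| <= r}%R.
Hypothesis nu_cube : {ae nu, forall x : E, forall j, `|x ord0 j| <= r}%R.

Lemma measurable_cost :
  measurable_fun setT (fun p : E * E => (enorm (p.1 - p.2)%R)%:E).
Proof.
apply/measurable_EFinP.
exact: (measurableT_comp (@measurable_enorm R n) (@measurable_subV R n)).
Qed.

Lemma transport_cost_ge0 (T : probability (E * E)%type R) :
  0 <= transport_cost T.
Proof. by apply: integral_ge0 => p _; rewrite lee_fin enorm_ge0. Qed.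

Lemma wasserstein_le_cost (T : probability (E * E)%type R) :
  is_coupling mu nu T -> wasserstein mu nu <= transport_cost T.
Proof. by move=> cT; apply: ereal_inf_lbound; exists T. Qed.

Lemma product_coupling : is_coupling mu nu (mu \x nu).
Proof.
split=> [A mA|B mB].
  rewrite (_ : fst @^-1` A = A `*` setT).
    apply: etrans (product_measure1E mu nu mA measurableT) _.
    exact: etrans (congr1 (mule (mu A)) (probability_setT nu)) (mule1 _).
  by apply/seteqP; split=> [p|p []].
rewrite (_ : snd @^-1` B = setT `*` B).
  apply: etrans (product_measure1E mu nu measurableT mB) _.
  exact: etrans (congr1 (mule^~ (nu B)) (probability_setT mu)) (mul1e _).
by apply/seteqP; split=> [p|p []].
Qed.

Lemma coupling_integral (T : probability (E * E)%type R) (f : E -> \bar R) :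
  is_coupling mu nu T -> measurable_fun setT f -> (forall x, 0 <= f x) ->
  \int[T]_p f p.1 = \int[mu]_x f x /\ \int[T]_p f p.2 = \int[nu]_x f x.
Proof.
move=> [T1 T2] mf f0; split.
  rewrite -(integral_law T measurable_fst mf f0).
  by apply: eq_measure_integral => A mA _; exact: T1.
rewrite -(integral_law T measurable_snd mf f0).
by apply: eq_measure_integral => A mA _; exact: T2.
Qed.

Lemma coupling_ae (T : probability (E * E)%type R) (F G : E -> Prop) :
  is_coupling mu nu T -> {ae mu, forall x, F x} -> {ae nu, forall x, G x} ->
  {ae T, forall p, F p.1 /\ G p.2}.
Proof.
move=> [T1 T2] [A [mA A0 Fc]] [B [mB B0 Gc]].
have mfA : measurable (fst @^-1` A : set (E * E)).
  by rewrite -[X in measurable X]setTI; exact: measurable_fst.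
have msB : measurable (snd @^-1` B : set (E * E)).
  by rewrite -[X in measurable X]setTI; exact: measurable_snd.
exists (fst @^-1` A `|` snd @^-1` B); split; first exact: measurableU.
  by apply: null_set_setU => //; [rewrite -A0 -T1|rewrite -B0 -T2].
move=> p /= /not_andP[nF|nG]; first by left; exact: Fc.
by right; exact: Gc.
Qed.

Lemma coupling_cube (T : probability (E * E)%type R) : is_coupling mu nu T ->
  {ae law T (@measurable_row_pair R n), forall z : 'rV[R]_(n + n),
    forall j, `|z ord0 j| <= r}%R.
Proof.
move=> [T1 T2]; have [A [mA A0 Ac]] := mu_cube; have [B [mB B0 Bc]] := nu_cube.
exists (lsubmx @^-1` A `|` rsubmx @^-1` B).
have mlA : measurable (lsubmx @^-1` A : set 'rV[R]_(n + n)).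
  by rewrite -[X in measurable X]setTI; exact: measurable_lsubmx.
have mrB : measurable (rsubmx @^-1` B : set 'rV[R]_(n + n)).
  by rewrite -[X in measurable X]setTI; exact: measurable_rsubmx.
split; first exact: measurableU.
  apply: null_set_setU => //.
    rewrite -A0 -T1// /law /distribution /pushforward/=; congr (T _).
    by apply/seteqP; split=> -[x y]; rewrite /row_pair/= row_mxKl.
  rewrite -B0 -T2// /law /distribution /pushforward/=; congr (T _).
  by apply/seteqP; split=> -[x y]; rewrite /row_pair/= row_mxKr.
move=> z /= zr; apply: contrapT => /not_orP[nA nB]; apply: zr => j.
have lr : forall i, (`|lsubmx z ord0 i| <= r)%R by apply: contrapT => /Ac.
have rr : forall i, (`|rsubmx z ord0 i| <= r)%R by apply: contrapT => /Bc.
rewrite -[z]hsubmxK mxE; case: (fintype.split j) => k; [exact: lr|exact: rr].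
Qed.

Theorem optimal_coupling_exists :
  exists T : probability (E * E)%type R, is_optimal_coupling mu nu T.
Proof.
(* If the infimum is infinite, every coupling has infinite cost and the product is optimal. *)
have [Woo|Wfin] := eqVneq (wasserstein mu nu) +oo.
  exists (mu \x nu); split; first exact: product_coupling.
  by move=> S /wasserstein_le_cost; rewrite Woo leye_eq => /eqP ->; exact: leey.
have {}Wfin : wasserstein mu nu \is a fin_num.
  rewrite ge0_fin_numE ?ltey//; apply: le_ereal_inf_tmp => _ [T _ <-].
  exact: transport_cost_ge0.
have /choice[T Tmin] : forall k : nat, exists T : probability (E * E)%type R,
    is_coupling mu nu T /\
    transport_cost T <= wasserstein mu nu + (k.+1%:R^-1)%:E.
  move=> k; have k0 : (0 < k.+1%:R^-1 :> R)%R by rewrite invr_gt0.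
  have [_ [T cT <-] /ltW TW] := lb_ereal_inf_adherent k0 Wfin.
  by exists T.
(* [ooU] transfers to [U] whatever holds for all large [k]. *)
have [U [UU ooU]] := ultraFilterLemma (eventually_filter).
have UP : ProperFilter U by exact: ultra_proper.
pose P k := law (T k) (@measurable_row_pair R n).
have [Q PQ] := weak_compactness UU r_ge0 (P := P)
  (fun k => coupling_cube (Tmin k).1).
pose S := law Q (@measurable_row_split R n).
have PT k (g : 'rV[R]_(n + n) -> R) : measurable_fun setT g ->
    (forall z, 0 <= g z)%R ->
    \int[P k]_z (g z)%:E = \int[T k]_p (g (row_pair p))%:E.
  by move=> mg g0; rewrite integral_law//; exact/measurable_EFinP.
(* An integral with the same value under all the [T k] keeps it in the limit; for functions of a
   single block this gives the marginals of [S]. *)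
have lim_uniq (g : 'rV[R]_(n + n) -> R) L c : (forall z, 0 <= g z)%R -> (0 <= L)%R ->
    (forall z z', `|g z - g z'| <= L * `|z - z'|)%R ->
    (forall k, \int[T k]_p (g (row_pair p))%:E = c) ->
    \int[Q]_z (g z)%:E = c.
  move=> g0 L0 gL gc; have mg := measurable_lipschitz gL.
  have := PQ _ _ mg g0 L0 gL.
  under eq_fun do rewrite PT// gc.
  by move=> h; apply: (cvg_unique _ h) => //; exact: cvg_cst.
have cS : is_coupling mu nu S.
  split.
    suff : law S measurable_fst ≡μ mu by [].
    apply: lipschitz_integral_unique => f L f0 L0 fL.
    have mf := measurable_lipschitz fL.
    have mfE : measurable_fun setT (EFin \o f) by exact/measurable_EFinP.
    have f0E x : 0 <= (EFin \o f) x by rewrite lee_fin.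
    rewrite (integral_law S measurable_fst mfE f0E) integral_law//; last first.
      exact: (measurableT_comp mfE measurable_fst).
    apply: (lim_uniq (f \o lsubmx) L) => //; first by move=> z; exact: f0.
      move=> z z'; rewrite (le_trans (fL _ _))// ler_wpM2l//.
      by rewrite -linearB norm_lsubmx.
    move=> k; rewrite -(coupling_integral (Tmin k).1 mfE f0E).1.
    by apply: eq_integral => p _; rewrite /row_pair/= row_mxKl.
  suff : law S measurable_snd ≡μ nu by [].
  apply: lipschitz_integral_unique => f L f0 L0 fL.
  have mf := measurable_lipschitz fL.
  have mfE : measurable_fun setT (EFin \o f) by exact/measurable_EFinP.
  have f0E x : 0 <= (EFin \o f) x by rewrite lee_fin.
  rewrite (integral_law S measurable_snd mfE f0E) integral_law//; last first.
    exact: (measurableT_comp mfE measurable_snd).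
  apply: (lim_uniq (f \o rsubmx) L) => //; first by move=> z; exact: f0.
    move=> z z'; rewrite (le_trans (fL _ _))// ler_wpM2l//.
    by rewrite -linearB norm_rsubmx.
  move=> k; rewrite -(coupling_integral (Tmin k).1 mfE f0E).2.
  by apply: eq_integral => p _; rewrite /row_pair/= row_mxKr.
exists S; split=> // S' /wasserstein_le_cost; apply: le_trans.
have mc := measurable_lipschitz (@split_cost_lipschitz R n).
have c0 z : (0 <= @split_cost R n z)%R by exact: enorm_ge0.
have L0 : (0 <= Num.sqrt n%:R * 2 :> R)%R by rewrite mulr_ge0// sqrtr_ge0.
have := PQ _ _ mc c0 L0 (@split_cost_lipschitz R n).
under eq_fun do rewrite PT//.
have -> : \int[Q]_z (split_cost z)%:E = transport_cost S.
  apply/esym/(integral_law Q (@measurable_row_split R n) measurable_cost).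
  by move=> p; rewrite lee_fin enorm_ge0.
(* It suffices to bound the limit cost by the infimum plus any positive [e], and the costs of the
   [T k] satisfy this bound for large [k]. *)
move=> cvgS; apply/lee_addgt0Pr => e e0.
have := cvg_lim (@ereal_hausdorff R) cvgS => <-.
apply: lime_le; first by apply/cvg_ex; exists (transport_cost S).
apply: ooU; near=> k.
rewrite (_ : integral _ _ _ = transport_cost (T k)); last first.
  by apply: eq_integral => p _; rewrite /split_cost /row_pair row_mxKl row_mxKr.
rewrite (le_trans (Tmin k).2)// leeD2l// lee_fin ltW//.
by near: k; exact: near_infty_natSinv_lt (PosNum e0).
Unshelve. all: by end_near. Qed.

End optimal_coupling.

(** * The PVF of a vector field *)

Section support.
Local Open Scope ereal_scope.
Context (R : realType) (n : nat).
Local Notation E := 'rV[R]_n.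

Lemma supp_full (mu : probability E R) (A : set E) : measurable A ->
  supp mu `<=` A -> mu A = 1.
Proof.
move=> mA sA.
(* The complement of A is covered by the countably many mu-null rational boxes. *)
pose box (c : 'rV[rat]_n * nat) : set E :=
  [set y | forall i, `|y ord0 i - ratr (c.1 ord0 i)| < c.2.+1%:R^-1]%R.
have mbox c : measurable (box c).
  rewrite (_ : box c = \bigcap_(i in [set: 'I_n])
      (fun y : E => y ord0 i) @^-1` ball (ratr (c.1 ord0 i) : R) c.2.+1%:R^-1).
    apply: fin_bigcap_measurable => // i _; rewrite -[X in measurable X]setTI.
    by apply: measurable_coord => //; apply: open_measurable; exact: ball_open.
  by apply/seteqP; split=> y /= H i; [move=> _|]; have := H i;
    rewrite /ball/= distrC => // /(_ Logic.I).
pose V c := if `[< mu (box c) = 0 >] then box c else set0.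
have V0 c : mu (V c) = 0 by rewrite /V; case: asboolP => // _; rewrite measure0.
have mV c : measurable (V c) by rewrite /V; case: asboolP.
have sV : ~` A `<=` \bigcup_c V c.
  move=> y nAy; have : ~ supp mu y by move=> /sA.
  move=> /existsNP[W] /not_implyP[oW] /not_implyP[Wy] /negP; rewrite -leNgt => W0.
  have /nbhs_ballP[e /= e0 yW] : nbhs y W by exact: open_nbhs_nbhs.
  have [k /= ke] : exists k : nat, (k.+1%:R^-1 < e / 2)%R.
    exists (Num.truncn (e / 2)^-1).
    by rewrite invf_plt ?posrE ?divr_gt0// truncnS_gt.
  have qP i : exists q : rat, (`|y ord0 i - ratr q| < k.+1%:R^-1 :> R)%R.
    have /rat_in_itvoo[q /itvP yq] :
        (y ord0 i - k.+1%:R^-1 < y ord0 i + k.+1%:R^-1 :> R)%R.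
      by rewrite ltrBlDr -addrA ltrDl addr_gt0// invr_gt0.
    by exists q; rewrite ltr_distlC !yq.
  pose c : 'rV[rat]_n := (\row_i projT1 (cid (qP i)))%R.
  have yc i : (`|y ord0 i - ratr (c ord0 i)| < k.+1%:R^-1 :> R)%R.
    by rewrite mxE; case: cid.
  have boxW : box (c, k) `<=` W.
    move=> z zc; apply: yW; split=> // i j; rewrite (ord1 i).
    rewrite /ball/= -(subrKA (ratr (c ord0 j))) (splitr e).
    rewrite (le_lt_trans (ler_normD _ _))// ltrD//.
      by rewrite (lt_trans (yc j)).
    by rewrite distrC (lt_trans (zc j)).
  exists (c, k) => //; rewrite /V asboolT//.
  apply: (@subset_measure0 _ _ _ mu _ W) => //.
    exact: measurable_open_rV.
  by apply/eqP; rewrite eq_le W0 measure_ge0.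
(* The countable family of boxes is reindexed by the natural numbers, with the empty set at indices
   that code no box. *)
pose F k := if unpickle k is Some c then V c else set0.
have nF : mu.-negligible (\bigcup_k F k).
  apply: negligible_bigcup => k; rewrite /F; case: unpickle => [c|].
    by apply/(negligibleP _ (mV c)); exact: V0.
  exact: negligible_set0.
have nA : mu.-negligible (~` A).
  apply: negligibleS nF => y /sV[c _ Vy].
  by exists (pickle c) => //; rewrite /F pickleK.
have A0 : mu (~` A) = 0 by apply/(negligibleP _ (measurableC mA)).
by have := probability_setC mu (measurableC mA); rewrite setCK A0 sube0.
Qed.

Lemma supp_ball_ae (mu : probability E R) (r : R) :
  supp mu `<=` [set x | (enorm x < r)%R] ->
  {ae mu, forall x : E, (enorm x < r)%R}.
Proof.
move=> sr; have mB : measurable [set x : E | (enorm x < r)%R].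
  rewrite -[X in measurable X]setTI.
  have := measurable_fun_ltr (@measurable_enorm R n) (measurable_cst r).
  by move=> /(_ measurableT [set true]); exact.
by apply: ae_full => //; exact: supp_full.
Qed.

End support.

(** * Growth and Lipschitz estimates for the PVF of a vector field *)

Section vector_fields.
Context (R : realType) (n : nat) (v : vec R n).
Local Notation E := 'rV[R]_n.

Lemma vec_lipschitz_ball (r : R) : exists2 K : R, 0 < K &
  forall y z, enorm y < r -> enorm z < r ->
    enorm (v y - v z) <= K * enorm (y - z).
Proof.
have [lv [C C0 vC]] := vecP v.
apply: contrapT => nK.
(* Otherwise pairs violating the bound with constants tending to infinity have
   vanishing distance and cluster at a point near which v is Lipschitz. *)
have /choice[p pP] : forall k : nat, exists p : E * E,
    [/\ enorm p.1 < r, enorm p.2 < r &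
      k.+1%:R * enorm (p.1 - p.2) < enorm (v p.1 - v p.2)].
  move=> k; apply: contrapT => np; apply: nK; exists k.+1%:R => // y z yr zr.
  by rewrite leNgt; apply/negP => yz; apply: np; exists (y, z).
pose B := [set y : E | forall i, `[- r, r]%classic (y ord0 i)].
have cB : compact B.
  exact: (@rV_compact R n (fun=> `[- r, r]%classic) (fun=> @segment_compact R _ _)).
have inB y : enorm y < r -> B y.
  move=> yr i; rewrite /= in_itv/= -ler_norml (le_trans (ler_coord_enorm _ _))//.
  exact: ltW.
have [x [_ xcl]] : (B `&` cluster ((fun k => (p k).1) @ \oo)) !=set0.
  by apply: cB; exists 0%N => // k _; apply: inB; have [] := pP k.
have [W xW [L vL]] := lv x.
have /nbhs_ballP[e /= e0 xeW] := xW.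
(* Sublinear growth bounds [v] on the ball, so the points of the [k]-th pair are at distance less
   than [2 * M / k.+1]. *)
have Mle y : enorm y < r -> enorm (v y) <= C * (1 + r).
  by move=> yr; rewrite (le_trans (vC y))// ler_wpM2l ?ltW// ltrD2l.
set M := C * (1 + r) in Mle.
(* The first threshold puts the two points within [e / 2] of each other, the second makes the
   violated constant [k.+1] at least [L]. *)
have near_k : \forall k \near \oo, 4 * M / e <= k%:R /\ L <= k%:R.
  by near=> k; split; near: k; exact: nbhs_infty_ger.
pose S := [set (p k).1 | k in [set k : nat | 4 * M / e <= k%:R /\ L <= k%:R]].
have pS : ((fun k => (p k).1) @ \oo) S.
  by apply: filterS near_k => k hk; exists k.
have ball_x : nbhs x (ball x (e / 2)) by apply: nbhsx_ballx; rewrite divr_gt0.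
have [_ [[k [kM kL] <-]]] := xcl _ _ pS ball_x.
have [p1r p2r pk] := pP k.
rewrite -ball_normE/= => xp1.
have vM : enorm (v (p k).1 - v (p k).2) <= 2 * M.
  rewrite (le_trans (ler_enormD _ _))// enormN mulr_natl mulr2n.
  by rewrite lerD ?Mle.
have p12 : `|(p k).1 - (p k).2| < e / 2.
  rewrite (le_lt_trans (norm_le_enorm _))//.
  move: kM; rewrite ler_pdivrMr// => kM.
  have := lt_le_trans pk vM; rewrite -natr1 => h.
  have k0 : 0 <= k%:R :> R by [].
  rewrite ltNge; apply/negP => eh.
  by have := ler_wpM2l k0 eh; have := enorm_ge0 ((p k).1 - (p k).2); nra.
have W1 : W (p k).1.
  apply: xeW; rewrite -ball_normE/= (lt_le_trans xp1)// ler_pdivrMr//.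
  by rewrite ler_peMr ?ler1n// ltW.
have W2 : W (p k).2.
  apply: xeW; rewrite -ball_normE/= -(subrKA (p k).1) (splitr e).
  by rewrite (le_lt_trans (ler_normD _ _))// ltrD.
have := lt_le_trans pk (vL _ _ W1 W2).
rewrite ltNge => /negP; apply; rewrite ler_wpM2r ?enorm_ge0//.
by rewrite (le_trans kL)// ler_nat.
Unshelve. all: by end_near. Qed.

Let mv : measurable_fun setT v := measurable_vec v.

Local Open Scope ereal_scope.

(** As the fibers are Dirac masses, the measure is the image of [mu] under x |-> (x, v x). *)
Lemma dirac_pvfE (mu : probability E R) B : measurable B ->
  dirac_pvf v mu B = mu [set x | B (x, v x)].
Proof.
move=> mB; have mG := measurable_graph_map mv.
have mB' : measurable [set x | B (x, v x)].
  by rewrite -[X in measurable X]setTI; exact: mG.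
apply: etrans (tensor_kdirac mu mv mB) _.
by rewrite -[X in mu X]setIT -integral_indic.
Qed.

(** The support lies above that of [mu] and, [v] being continuous, inside the graph of [v]; the
    growth bound of [v] then applies at each of its points. *)
Lemma dirac_pvf_sublinear : sublinear_pvf (dirac_pvf v).
Proof.
have [_ [C C0 vC]] := vecP v; exists C => // mu _.
have mG := measurable_graph_map mv.
have supp_fst p : supp (dirac_pvf v mu) p -> supp mu p.1.
  move=> sp U oU Up; have mU := measurable_open_rV oU.
  have oU' : open (fst @^-1` U : set (E * E)).
    by apply: open_comp => // q _; exact: cvg_fst.
  have := sp _ oU' Up; congr (0 < _).
  apply: dirac_pvfE; rewrite -[X in measurable X]setTI.
  exact: measurable_fst.
have supp_snd p : supp (dirac_pvf v mu) p -> p.2 = v p.1.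
  move=> sp; apply: contrapT => /eqP; rewrite -subr_eq0 -normr_gt0.
  set e := (`|_|)%R => e_gt0.
  have [K K0 vK] := vec_lipschitz_ball (enorm p.1 + 1)%R.
  have c0 : (0 < Num.sqrt n%:R + 1 :> R)%R by rewrite ltr_wpDl// sqrtr_ge0.
  (* The bound 1 keeps [x] in the ball where [v] is [K]-Lipschitz, and [e / 2 / K] keeps [v x]
     within [e / 2] of [v p.1]. Dividing by [Num.sqrt n%:R + 1] below passes from sup-norm balls to
     [enorm]. *)
  pose m : R := Num.min 1%R (e / 2 / K)%R.
  have m0 : (0 < m)%R by rewrite lt_min ltr01 !divr_gt0.
  pose U : set (E * E) := (fst @^-1` ball p.1 (m / (Num.sqrt n%:R + 1))%R) `&`
    (snd @^-1` ball p.2 (e / 2)%R).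
  have e20 : (0 < e / 2)%R by rewrite divr_gt0.
  have d0 : (0 < m / (Num.sqrt n%:R + 1))%R by rewrite divr_gt0.
  have mU : measurable U.
    apply: measurableI; rewrite -[X in measurable X]setTI;
      [apply: measurable_fst|apply: measurable_snd] => //;
      by apply: measurable_open_rV; exact: ball_open.
  have oU : open U.
    by apply: openI; apply: open_comp => [q _|]; [exact: cvg_fst|
      exact: ball_open|exact: cvg_snd|exact: ball_open].
  have Up : U p by split; exact: ballxx.
  have := sp _ oU Up; rewrite dirac_pvfE// (_ : [set x | _] = set0).
    by rewrite measure0 ltxx.
  apply/seteqP; split=> // x [] /=; rewrite -!ball_normE/= => xp vx.
  have xpm : (enorm (x - p.1) < m)%R.
    move: xp; rewrite ltr_pdivlMr// distrC; apply: le_lt_trans.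
    rewrite (le_trans (ler_enorm_norm _))// mulrC ler_wpM2l// lerDl//.
  have xr : (enorm x < enorm p.1 + 1)%R.
    rewrite -(subrK p.1 x) addrC (le_lt_trans (ler_enormD _ _))// ltrD2l.
    by rewrite (lt_le_trans xpm)// ge_min lexx.
  have pr : (enorm p.1 < enorm p.1 + 1)%R by rewrite ltrDl.
  have vxp : (`|v x - v p.1| < e / 2)%R.
    rewrite (le_lt_trans (norm_le_enorm _))// (le_lt_trans (vK _ _ xr pr))//.
    rewrite mulrC -ltr_pdivlMr// (lt_le_trans xpm)// ge_min lexx orbT//.
  suff : (e < e)%R by rewrite ltxx.
  rewrite {1}/e -(subrKA (v x)) (splitr e).
  by rewrite (le_lt_trans (ler_normD _ _))// ltrD.
apply: ge_ereal_sup => _ [p sp <-].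
rewrite (supp_snd _ sp).
apply: (@le_trans _ _ (C%:E * (1 + (enorm p.1)%:E))).
  by rewrite -EFinD -EFinM lee_fin.
rewrite lee_pmul2l ?lte_fin// leeD2l//.
by apply: ereal_sup_ubound; exists p.1 => //; exact: supp_fst.
Qed.

Lemma dirac_pvf_lipschitz : lipschitz_pvf (dirac_pvf v).
Proof.
move=> r r0; have [K K0 vK] := vec_lipschitz_ball r.
exists K => // mu nu /supp_ball_ae mur /supp_ball_ae nur.
have cube (m : probability E R) : {ae m, forall x : E, (enorm x < r)%R} ->
    {ae m, forall x : E, forall j, (`|x ord0 j| <= r)%R}.
  apply: filterS => x xr j.
  by rewrite (le_trans (ler_coord_enorm x j))// ltW.
have [T [cT Tmin]] := optimal_coupling_exists (ltW r0) (cube _ mur) (cube _ nur).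
pose h (p : E * E) : (E * E) * (E * E) := ((p.1, v p.1), (p.2, v p.2)).
have mh : measurable_fun setT h.
  by apply: measurable_fun_pair;
    apply: (measurableT_comp (measurable_graph_map mv)).
have cTh : is_coupling (dirac_pvf v mu) (dirac_pvf v nu) (law T mh).
  split=> B mB; rewrite dirac_pvfE//.
    rewrite -cT.1//; rewrite -[X in measurable X]setTI.
    exact: measurable_graph_map.
  rewrite -cT.2//; rewrite -[X in measurable X]setTI.
  exact: measurable_graph_map.
have pi1E (m : probability E R) : distribution (dirac_pvf v m) (@pi1 R n) ≡μ m.
  exact: pvf_marginal.
(* The base marginals in [fiber_wasserstein] agree with [mu] and [nu] only on measurable sets;
   couplings do not see the difference. *)
have coupE S : is_coupling (distribution (dirac_pvf v mu) (@pi1 R n))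
    (distribution (dirac_pvf v nu) (@pi1 R n)) S <-> is_coupling mu nu S.
  by split=> -[S1 S2]; split=> B mB; rewrite ?S1 ?S2// pi1E.
(* [pi13] undoes [h], so the base projection of the lifted coupling is [T]. *)
have costE : transport_cost (distribution (law T mh) (@pi13 R n)) =
    transport_cost T.
  by apply: eq_measure_integral => A mA _; congr (T _); apply/seteqP;
    split=> -[x y].
apply: (@le_trans _ _ (\int[law T mh]_z (enorm (z.1.2 - z.2.2)%R)%:E)).
  apply: ereal_inf_lbound; exists (law T mh) => //; split=> //; split.
    apply/coupE; split=> B mB; [rewrite -cT.1//|rewrite -cT.2//].
  by move=> S /coupE cS; rewrite costE; exact: Tmin.
apply: (@le_trans _ _ (K%:E * transport_cost T)); last first.
  rewrite lee_pmul2l ?lte_fin//; apply: le_ereal_inf_tmp => _ [S cS <-].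
  exact: Tmin.
have mc := @measurable_cost R n.
have mc' : measurable_fun setT
    (fun z : (E * E) * (E * E) => (enorm (z.1.2 - z.2.2)%R)%:E).
  apply: (measurableT_comp mc (_ : measurable_fun setT
    (fun z : (E * E) * (E * E) => (z.1.2, z.2.2)))).
  apply: measurable_fun_pair.
    exact: (measurableT_comp measurable_snd measurable_fst).
  exact: (measurableT_comp measurable_snd measurable_snd).
rewrite integral_law//; last by move=> z; rewrite lee_fin enorm_ge0.
rewrite /transport_cost -ge0_integralZl_EFin ?(ltW K0)//; last first.
  by move=> p _; rewrite lee_fin enorm_ge0.
apply: ae_ge0_le_integral => //.
- by move=> p _; rewrite lee_fin enorm_ge0.
- exact: (measurableT_comp mc' mh).
- by move=> p _; rewrite -EFinM lee_fin mulr_ge0 ?enorm_ge0// ltW.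
- exact: measurable_funeM.
(* Almost surely both endpoints lie in the ball on which [vK] holds. *)
apply: filterS (coupling_ae cT mur nur) => p [p1r p2r] _.
by rewrite -EFinM lee_fin vK.
Qed.

End vector_fields.

(** Isomorphism is understood onto the image, with PVFs compared by [pvf_eq]. For positive [n] the
    image is not all of [PVec]: giving every fiber mass 1/2 at u and at -u, for a unit vector u,
    defines an element of [PVec] that comes from no vector field. *)
Theorem proposition6p4 (R : realType) (n : nat) :
  [/\ (forall v : vec R n, PVec (dirac_pvf v)),
      (forall v w : vec R n, pvf_eq (dirac_pvf v) (dirac_pvf w) -> v = w),
      pvf_eq (dirac_pvf (0 : vec R n)) zero_pvf,
      (forall v w : vec R n,
        pvf_eq (dirac_pvf (v + w)) (fiber_add (dirac_pvf v) (dirac_pvf w)))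
    & (forall (a : R) (v : vec R n),
        pvf_eq (dirac_pvf (a *: v)) (fiber_scale a (dirac_pvf v)))].
Proof.
split; last exact: dirac_pvfZ.
- by move=> v; split; [exact: dirac_pvf_sublinear|exact: dirac_pvf_lipschitz].
- exact: dirac_pvf_inj.
- exact: dirac_pvf0.
- exact: dirac_pvfD.
Qed.
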